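(* Let $I$ be a non-empty set and let $w=(w_i)_{i\in I}$ satisfy $w_i>0$ for all $i$. Define $$E=c_0(I,w):=\bigl\{x=(x_i)_{i\in I}\in\mathbb{C}^I:\ \{i\in I: w_i|x_i|\ge\varepsilon\}\text{ is finite for every }\varepsilon>0\bigr\},\qquad \|x\|_E:=\sup_{i\in I}w_i|x_i|.$$ Then: (a) One has $E\subseteq\ell_\infty(I)$ if and only if $\inf_{i\in I}w_i>0$. Moreover, $E$ is a Banach sequence lattice on $I$ if and only if $\inf_{i\in I}w_i\ge1$. (b) For every non-empty finite $F\subseteq I$, $\|\chi_F\|_E=\max_{i\in F}w_i$, and hence $C_E=\sup_{i\in I}w_i$; this value lies in $[1,\infty]$ when $E$ is a Banach sequence lattice. (c) Assume in addition that $\inf_{i\in I}w_i\ge1$, let $(A_i)_{i\in I}$ be a family of Banach algebras and let $A=\bigl(\bigoplus_{i\in I}A_i\bigr)_E$ be the corresponding $E$-sum Banach algebra. Then $$\sup_{i\in I}\mathrm{AM}(A_i)\ \le\ \mathrm{AM}(A)\ \le\ C_E^2\,\sup_{i\in I}\mathrm{AM}(A_i)\ =\ \Bigl(\sup_{i\in I}w_i\Bigr)^2\sup_{i\in I}\mathrm{AM}(A_i).$$ In particular, if $\sup_iw_i<\infty$ and $\sup_i\mathrm{AM}(A_i)<\infty$, then $A$ is amenable. If $I$ is infinite and each $A_i$ is non-zero, then amenability of $A$ forces $\sup_iw_i<\infty$.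
   Context: All Banach spaces and algebras are complex. $c_{00}(I)$ denotes the finitely supported complex functions on $I$, and $\chi_F$ the characteristic function of $F\subseteq I$. $C_E:=\sup\{\|\chi_F\|_E: F\subseteq I\text{ finite}\}$. Amenability constant. For a Banach algebra $A$, $A\widehat{\otimes}A$ is the projective tensor product, $\pi\colon A\widehat{\otimes}A\to A$ is the product map $\pi(a\otimes b)=ab$, and $A\widehat{\otimes}A$ is an $A$-bimodule via $a\cdot(x\otimes y)=(ax)\otimes y$, $(x\otimes y)\cdot a=x\otimes(ya)$; the actions extend canonically to $(A\widehat{\otimes}A)^{**}$. A virtual diagonal for $A$ is $M\in(A\widehat{\otimes}A)^{**}$ with $a\cdot M=M\cdot a$ and $a\cdot\pi^{**}(M)=a=\pi^{**}(M)\cdot a$ for all $a\in A$. $A$ is amenable if it has a virtual diagonal; then $\mathrm{AM}(A):=\inf\{\|M\|: M \text{ a virtual diagonal for } A\}$, and $\mathrm{AM}(A):=+\infty$ if $A$ is not amenable. Banach sequence lattice. A Banach sequence lattice on $I$ is a Banach space $E$ of complex-valued functions on $I$ such that (a) $c_{00}(I)\subseteq E\subseteq\ell_\infty(I)$ and $c_{00}(I)$ is dense in $E$; (b) $E$ is solid: if $y\in E$, $x\in\ell_\infty(I)$ and $|x_i|\le|y_i|$ for all $i$, then $x\in E$ and $\|x\|_E\le\|y\|_E$; (c) $\|x\|_\infty\le\|x\|_E$ for all $x\in E$. $E$-sum. $\bigl(\bigoplus_{i\in I}A_i\bigr)_E$ is the Banach algebra of all families $a=(a_i)_{i\in I}$,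 $a_i\in A_i$, with $(\|a_i\|)_{i\in I}\in E$, with norm $\|a\|=\|(\|a_i\|)_{i\in I}\|_E$ and coordinatewise multiplication. *)

(* Defs.v *)
From HB Require Import structures.
From mathcomp Require Import all_boot all_order all_algebra.
From mathcomp Require Import complex finmap generic_quotient.
From mathcomp Require Import mathcomp_extra boolp classical_sets functions.
From mathcomp Require Import cardinality reals ereal topology normedtype.
From mathcomp Require Import sequences.

Set Implicit Arguments.
Unset Strict Implicit.
Unset Printing Implicit Defensive.

Import Order.TTheory GRing.Theory Num.Theory.
Import numFieldNormedType.Exports.

Local Open Scope classical_set_scope.
Local Open Scope ring_scope.
Local Open Scope complex_scope.

(* Norms on modules over [R[i]] take their values in [R[i]]; [rnorm] is the
   same norm as an element of [R]. *)
Section RealNorm.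
Variables (R : realType) (V : normedZmodType R[i]).
Implicit Types x y : V.

Definition rnorm x : R := complex.Re `|x|.

Lemma rnormE x : `|x| = (rnorm x)%:C.
Proof. by rewrite /rnorm RRe_real// normr_real. Qed.

Lemma rnorm_ge0 x : 0 <= rnorm x.
Proof. by rewrite -ler0c -rnormE. Qed.

Lemma rnorm0 : rnorm (0 : V) = 0.
Proof. by rewrite /rnorm normr0. Qed.

Lemma rnorm0_eq0 x : rnorm x = 0 -> x = 0.
Proof. by move=> x0; apply/eqP; rewrite -normr_eq0 rnormE x0. Qed.

Lemma ler_rnormD x y : rnorm (x + y) <= rnorm x + rnorm y.
Proof. by rewrite -lecR rmorphD/= -!rnormE ler_normD. Qed.

Lemma rnormN x : rnorm (- x) = rnorm x.
Proof. by rewrite /rnorm normrN. Qed.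

Lemma rnormB x y : rnorm (x - y) = rnorm (y - x).
Proof. by rewrite -rnormN opprB. Qed.

Lemma ler_rnormB x y : rnorm (x - y) <= rnorm x + rnorm y.
Proof. by rewrite (le_trans (ler_rnormD _ _))// rnormN. Qed.

Lemma ler_dist_rnorm x y : `|rnorm x - rnorm y| <= rnorm (x - y).
Proof.
rewrite ler_distl; apply/andP; split.
  by have := ler_rnormD (y - x) x; rewrite subrK rnormB lerBlDl.
by have := ler_rnormD (x - y) y; rewrite subrK addrC.
Qed.

End RealNorm.

Section RealNormModule.
Variables (R : realType).
Implicit Types V W : normedModType R[i].

Lemma rnormZ V (a : R[i]) (x : V) : rnorm (a *: x) = rnorm a * rnorm x.
Proof. by apply: complexI; rewrite rmorphM/= -!rnormE normrZ. Qed.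

Lemma rnormM (a b : R[i]) : rnorm (a * b) = rnorm a * rnorm b.
Proof. by apply: complexI; rewrite rmorphM/= -!rnormE normrM. Qed.

Lemma rnormC (r : R) : rnorm (r%:C) = `|r|.
Proof. by rewrite /rnorm normc_def/= expr0n/= addr0 sqrtr_sqr. Qed.

Lemma rnorm_norm V (x : V) : rnorm `|x| = rnorm x.
Proof. by rewrite rnormE rnormC ger0_norm// rnorm_ge0. Qed.

Lemma cvg_rnormP V (u : nat -> V) (l : V) :
  u @ \oo --> l <-> rnorm (u n - l) @[n --> \oo] --> (0 : R).
Proof.
split.
  move/cvgrPdist_lt => ul; apply/cvgrPdist_lt => e e0.
  have := ul e%:C; rewrite ltcR => /(_ e0); apply: filterS => n.
  by rewrite rnormE ltcR sub0r normrN ger0_norm ?rnorm_ge0// rnormB.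
move/cvgrPdist_lt => ul; apply/cvgrPdist_lt => -[e e'].
rewrite ltcE/= => /andP[/eqP -> e0].
have := ul e e0; apply: filterS => n.
by rewrite rnormE ltcR sub0r normrN ger0_norm ?rnorm_ge0// rnormB.
Qed.

Lemma seq_complete V :
  (forall u : nat -> V,
    (forall e : R, 0 < e ->
      \forall n \near \oo, forall m, (n <= m)%N -> rnorm (u m - u n) < e) ->
    exists l : V, rnorm (u n - l) @[n --> \oo] --> (0 : R)) ->
  forall F : set_system V, ProperFilter F -> cauchy F -> cvg F.
Proof.
move=> Vcvg F FF /cauchyP Fc.
have Hx (n : nat) : exists x : V, F (ball x (n.+1%:R^-1 : R)%:C).
  by apply: Fc; rewrite ltcR invr_gt0.
have [u Fu] := choice Hx.
have [|l ul] := Vcvg u.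
  move=> e e0; have e20 : 0 < e / 2 by rewrite divr_gt0.
  have : \forall n \near \oo, (n.+1%:R^-1 : R) < e / 2.
    exact: (near_infty_natSinv_lt (PosNum e20)).
  move=> [N _ HN]; exists N => // n /= Nn m nm.
  have [z [um un]] := filter_ex (filterI (Fu m) (Fu n)).
  move: um un; rewrite -!ball_normE /= !rnormE !ltcR => um un.
  have -> : u m - u n = (u m - z) - (u n - z) by rewrite opprB addrA subrK.
  rewrite (le_lt_trans (ler_rnormB _ _))// [e]splitr ltrD//.
    by rewrite (lt_trans um)// HN/= ?(leq_trans Nn).
  by rewrite (lt_trans un)// HN.
apply/cvg_ex; exists l; apply/cvgrPdist_lt => -[e e'].
rewrite ltcE/= => /andP[/eqP -> e0].
have e20 : 0 < e / 2 by rewrite divr_gt0.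
have [N _ HN] : \forall n \near \oo,
    ((n.+1%:R^-1 : R) < e / 2) /\ rnorm (u n - l) < e / 2.
  near=> n; split; first by near: n; exact: (near_infty_natSinv_lt (PosNum e20)).
  near: n; move/cvgrPdist_lt: ul => /(_ _ e20); apply: filterS => n.
  by rewrite sub0r normrN ger0_norm// rnorm_ge0.
have [uN1 uN2] := HN N (leqnn N).
move: (Fu N); apply: filterS => z; rewrite -ball_normE /= !rnormE !ltcR => uz.
have -> : l - z = (u N - z) - (u N - l) by rewrite opprB [RHS]addrC subrKA.
by rewrite (le_lt_trans (ler_rnormB _ _))// [e]splitr ltrD// (lt_trans uz).
Unshelve. all: by end_near. Qed.

End RealNormModule.

(* Bounded (that is, continuous) linear operators with the operator norm. *)
Section BoundedOperators.
Variables (R : realType) (V W : normedModType R[i]).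

Definition bop_pred : {pred V -> W} :=
  fun f => `[< linear f /\ continuous f >].

Record bop := Bop { bop_fun :> V -> W ; bop_funP : bop_fun \in bop_pred }.

HB.instance Definition _ := [isSub for bop_fun].
HB.instance Definition _ := [Choice of bop by <:].

Lemma bop_linear (f : bop) : linear f.
Proof. by case: f => f /= /asboolP[]. Qed.

Lemma bop_continuous (f : bop) : continuous f.
Proof. by case: f => f /= /asboolP[]. Qed.

HB.instance Definition _ (f : bop) :=
  GRing.isLinear.Build R[i] V W *:%R f (bop_linear f).

Lemma bopP (f g : bop) : f =1 g -> f = g.
Proof. by move=> fg; apply/val_inj/funext. Qed.

Lemma bounded_bop_pred (f : V -> W) (M : R) : linear f ->
  (forall x, rnorm (f x) <= M * rnorm x) -> f \in bop_pred.
Proof.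
move=> lf fM; apply/asboolP; split=> //.
pose fl := GRing.isLinear.Build R[i] V W *:%R f lf.
pose f' : {linear V -> W} := HB.pack f fl.
apply: (@bounded_linear_continuous _ _ _ f'); apply/linear_boundedP.
exists M%:C; split; first by apply/complex_realP; exists M.
move=> r Mr x; apply: le_trans (_ : M%:C * `|x| <= _).
  by rewrite !rnormE -rmorphM lecR fM.
by rewrite ler_wpM2r// ltW.
Qed.

Definition mkbop (f : V -> W) (M : R) (lf : linear f)
  (fM : forall x, rnorm (f x) <= M * rnorm x) : bop :=
  Bop (bounded_bop_pred lf fM).

Lemma bop_bounded (f : bop) :
  exists2 M : R, 0 <= M & forall x, rnorm (f x) <= M * rnorm x.
Proof.
have /linear_bounded_continuous/linear_boundedP := @bop_continuous f.
case/pinfty_ex_gt0 => -[M M']; rewrite ltcE/= => /andP[/eqP -> M0] fM.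
exists M; first exact: ltW.
by move=> x; rewrite -lecR rmorphM/= -!rnormE fM.
Qed.

Lemma bop_submod : submod_closed bop_pred.
Proof.
split.
  apply: (@bounded_bop_pred _ 0) => [a x y|x] /=.
    by rewrite scaler0 addr0.
  by rewrite rnorm0 mul0r.
move=> a f g fP gP.
have [M M0 fM] := bop_bounded (Bop fP).
have [N N0 gN] := bop_bounded (Bop gP).
apply: (@bounded_bop_pred _ (rnorm a * M + N)) => [b x y|x] /=.
  change (a *: f (b *: x + y) + g (b *: x + y) =
    b *: (a *: f x + g x) + (a *: f y + g y)).
  have -> : f (b *: x + y) = b *: f x + f y := bop_linear (Bop fP) b x y.
  have -> : g (b *: x + y) = b *: g x + g y := bop_linear (Bop gP) b x y.
  by rewrite !scalerDr !scalerA [b * a]mulrC addrACA.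
change (rnorm (a *: f x + g x) <= (rnorm a * M + N) * rnorm x).
rewrite mulrDl (le_trans (ler_rnormD _ _))// lerD ?gN//.
by rewrite rnormZ -mulrA ler_wpM2l ?rnorm_ge0// fM.
Qed.

HB.instance Definition _ := GRing.isSubmodClosed.Build _ _ bop_pred bop_submod.
HB.instance Definition _ := [SubChoice_isSubLmodule of bop by <:].

Definition opnorm (f : bop) : R :=
  sup [set rnorm (f x) | x in [set x | rnorm x <= 1]].

Let opnorm_has_sup (f : bop) :
  has_sup [set rnorm (f x) | x in [set x | rnorm x <= 1]].
Proof.
split; first by exists (rnorm (f 0)), 0 => //=; rewrite rnorm0.
have [M M0 fM] := bop_bounded f.
by exists M => _ /= [x x1 <-]; rewrite (le_trans (fM _))// ler_piMr.
Qed.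

Lemma opnorm_ge0 (f : bop) : 0 <= opnorm f.
Proof.
apply: sup_upper_bound (opnorm_has_sup f) _ _.
by exists 0; rewrite /= ?rnorm0 ?linear0 ?rnorm0.
Qed.

Lemma opnormP (f : bop) x : rnorm (f x) <= opnorm f * rnorm x.
Proof.
have [->|x0] := eqVneq x 0; first by rewrite linear0 !rnorm0 mulr0.
have nx : 0 < rnorm x.
  by rewrite lt0r rnorm_ge0 andbT; apply: contra_neq x0; exact: rnorm0_eq0.
rewrite -ler_pdivrMr//; apply: sup_upper_bound (opnorm_has_sup f) _ _.
exists ((rnorm x)^-1%:C *: x) => /=.
  by rewrite rnormZ rnormC gtr0_norm ?invr_gt0// mulVf// gt_eqF.
by rewrite linearZ/= rnormZ rnormC gtr0_norm ?invr_gt0// mulrC.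
Qed.

Lemma opnorm_le (f : bop) M : 0 <= M ->
  (forall x, rnorm (f x) <= M * rnorm x) -> opnorm f <= M.
Proof.
move=> M0 fM; apply: ge_sup; first by case: (opnorm_has_sup f).
by move=> _ /= [x x1 <-]; rewrite (le_trans (fM _))// ler_piMr.
Qed.

Let norm (f : bop) : R[i] := (opnorm f)%:C.

Let norm_ler_normD f g : norm (f + g) <= norm f + norm g.
Proof.
rewrite /norm -rmorphD lecR opnorm_le// ?addr_ge0 ?opnorm_ge0// => x.
by rewrite mulrDl (le_trans (ler_rnormD _ _))// lerD// opnormP.
Qed.

Let norm_normrZ (a : R[i]) f : norm (a *: f) = `|a| * norm f.
Proof.
suff Z b g : opnorm (b *: g) <= rnorm b * opnorm g.
  rewrite /norm rnormE -rmorphM; congr (_%:C); apply/eqP.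
  rewrite eq_le Z andTb.
  have [->|a0] := eqVneq a 0; first by rewrite rnorm0 mul0r opnorm_ge0.
  have na : 0 < rnorm a.
    by rewrite lt0r rnorm_ge0 andbT; apply: contra_neq a0; exact: rnorm0_eq0.
  rewrite -ler_pdivlMl// -{1}[f](scalerK a0) (le_trans (Z _ _))//.
  rewrite ler_wpM2r ?opnorm_ge0// -[leRHS]mul1r ler_pdivlMr//.
  by rewrite -rnormM mulVf// rnormC normr1.
apply: opnorm_le => [|x]; first by rewrite mulr_ge0 ?rnorm_ge0 ?opnorm_ge0.
by rewrite rnormZ -mulrA ler_wpM2l ?rnorm_ge0// opnormP.
Qed.

Let norm_normr0_eq0 f : norm f = 0 -> f = 0.
Proof.
move=> [f0]; apply/bopP => x; apply: rnorm0_eq0; apply/eqP.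
rewrite eq_le rnorm_ge0 andbT (le_trans (opnormP _ _))//.
by rewrite f0 mul0r.
Qed.

HB.instance Definition _ := Lmodule_isNormed.Build R[i] bop
  norm_ler_normD norm_normrZ norm_normr0_eq0.

Lemma bop_rnormE (f : bop) : rnorm f = opnorm f.
Proof. by []. Qed.

Lemma ler_rnorm_bop (f : bop) x : rnorm (f x) <= rnorm f * rnorm x.
Proof. exact: opnormP. Qed.

End BoundedOperators.

Section CauchySequences.
Variable R : realType.

Lemma seq_lim_unique (K : numFieldType) (V : pseudoMetricNormedZmodType K)
    (u : nat -> V) (a b : V) :
  u n @[n --> \oo] --> a -> u n @[n --> \oo] --> b -> a = b.
Proof. exact: norm_cvg_unique. Qed.

Lemma real_cauchy_cvg (r : nat -> R) :
  (forall e, 0 < e -> exists N, forall m n, (N <= m)%N -> (N <= n)%N ->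
     `|r m - r n| < e) -> cvg (r @ \oo).
Proof.
move=> rc; apply: cauchy_cvg; apply: cauchy_exP => e e0.
have [N HN] := rc e e0; exists (r N), N => // n /= Nn.
by rewrite -ball_normE /=; exact: HN.
Qed.

Lemma cauchy_seq_cvg (Z : completeNormedModType R[i]) (u : nat -> Z) :
  (forall e : R, 0 < e -> exists N, forall m n, (N <= m)%N -> (N <= n)%N ->
     rnorm (u m - u n) < e) -> cvg (u @ \oo).
Proof.
move=> uc; apply: cauchy_cvg; apply: cauchy_exP => -[e e'].
rewrite ltcE/= => /andP[/eqP -> e0].
have [N HN] := uc e e0; exists (u N), N => // n /= Nn.
by rewrite -ball_normE /= rnormE ltcR; exact: HN.
Qed.

Lemma cvg_rnorm (V : normedModType R[i]) (u : nat -> V) (l : V) :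
  u @ \oo --> l -> rnorm (u n) @[n --> \oo] --> rnorm l.
Proof.
move=> /cvg_rnormP/cvgrPdist_lt ul; apply/cvgrPdist_lt => e e0.
have := ul e e0; apply: filterS => n.
rewrite sub0r normrN ger0_norm ?rnorm_ge0//; apply: le_lt_trans.
by rewrite distrC ler_dist_rnorm.
Qed.

Lemma cvg_mul_cst (a l : R) (r : nat -> R) :
  r n @[n --> \oo] --> l -> a * r n @[n --> \oo] --> a * l.
Proof. by move=> rl; apply: cvgM => //; exact: cvg_cst. Qed.

End CauchySequences.
Arguments cvg_mul_cst {R} a {l r}.

(* The Hausdorff completion of a seminormed space: Cauchy sequences modulo
   null sequences. *)
Record seminorm (R : realType) (V : lmodType R[i]) := Seminorm {
  snorm :> V -> R ;
  ler_snormD : forall x y, snorm (x + y) <= snorm x + snorm y ;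
  snormZ : forall (a : R[i]) x, snorm (a *: x) = rnorm a * snorm x }.

Section Completion.
Variables (R : realType) (V : lmodType R[i]) (p : seminorm V).

Lemma snorm0 : p 0 = 0.
Proof. by rewrite -(scale0r (0 : V)) snormZ rnorm0 mul0r. Qed.

Lemma snormN x : p (- x) = p x.
Proof. by rewrite -scaleN1r snormZ rnormN rnormC normr1 mul1r. Qed.

Lemma snormB x y : p (x - y) = p (y - x).
Proof. by rewrite -snormN opprB. Qed.

Lemma snorm_ge0 x : 0 <= p x.
Proof.
have := ler_snormD p x (- x); rewrite subrr snorm0 snormN -mulr2n.
by rewrite pmulrn_lge0.
Qed.

Lemma ler_dist_snorm x y : `|p x - p y| <= p (x - y).
Proof.
rewrite ler_distl; apply/andP; split.
  by have := ler_snormD p (y - x) x; rewrite subrK snormB lerBlDl.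
by have := ler_snormD p (x - y) y; rewrite subrK addrC.
Qed.

Definition cauchy_pred : {pred nat -> V} := fun u =>
  `[< forall e, 0 < e -> exists N, forall m n, (N <= m)%N -> (N <= n)%N ->
      p (u m - u n) < e >].

Record cauchyseq :=
  CauchySeq { cseq :> nat -> V ; cseqP : cseq \in cauchy_pred }.

HB.instance Definition _ := [isSub for cseq].
HB.instance Definition _ := [Choice of cauchyseq by <:].

Lemma cauchy_submod : submod_closed cauchy_pred.
Proof.
split.
  apply/asboolP => e e0; exists 0%N => m n _ _.
  by rewrite (_ : _ - _ = 0) ?snorm0//; exact: subrr.
move=> a u v /asboolP uc /asboolP vc; apply/asboolP => e e0.
have na : 0 < rnorm a + 1 by rewrite ltr_wpDl ?rnorm_ge0.
have [|N1 H1] := uc (e / 2 / (rnorm a + 1)); first by rewrite !divr_gt0.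
have [|N2 H2] := vc (e / 2); first by rewrite divr_gt0.
exists (maxn N1 N2) => m n; rewrite !geq_max => /andP[m1 m2] /andP[n1 n2].
change (p ((a *: u m + v m) - (a *: u n + v n)) < e).
rewrite opprD addrACA -scalerBr [e]splitr.
rewrite (le_lt_trans (ler_snormD _ _ _))// ltr_leD//; last exact/ltW/H2.
rewrite snormZ (le_lt_trans (_ : _ <= (rnorm a + 1) * p (u m - u n)))//.
  by rewrite ler_wpM2r ?snorm_ge0// lerDl.
by rewrite mulrC -ltr_pdivlMr// H1.
Qed.

HB.instance Definition _ :=
  GRing.isSubmodClosed.Build _ _ cauchy_pred cauchy_submod.
HB.instance Definition _ := [SubChoice_isSubLmodule of cauchyseq by <:].

Definition null (u : cauchyseq) := p (u n) @[n --> \oo] --> (0 : R).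

Lemma nullP (u : cauchyseq) : null u <->
  forall e, 0 < e -> exists N, forall n, (N <= n)%N -> p (u n) < e.
Proof.
split=> [/cvgrPdist_lt un e e0|un].
  have [N _ HN] := un e e0; exists N => n Nn.
  by have := HN n Nn; rewrite /= sub0r normrN ger0_norm// snorm_ge0.
apply/cvgrPdist_lt => e e0; have [N HN] := un e e0; exists N => // n /= Nn.
by rewrite sub0r normrN ger0_norm ?snorm_ge0// HN.
Qed.

Lemma null0 : null 0.
Proof. by apply/nullP => e e0; exists 0%N => n _; rewrite /= snorm0. Qed.

Lemma null_le (a : R) (u v w : cauchyseq) :
  (forall n, p (w n) <= a * p (u n) + p (v n)) -> null u -> null v -> null w.
Proof.
move=> wuv un vn.
have uv0 : a * p (u n) + p (v n) @[n --> \oo] --> (0 : R).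
  by have := cvgD (cvg_mul_cst a un) vn; rewrite mulr0 addr0; apply.
apply: (squeeze_cvgr _ (cvg_cst 0) uv0).
by near=> n; rewrite snorm_ge0 wuv.
Unshelve. all: by end_near. Qed.

Lemma nullZD (a : R[i]) u v : null u -> null v -> null (a *: u + v).
Proof.
apply: (@null_le (rnorm a)) => n.
by rewrite -snormZ; exact: ler_snormD.
Qed.

Lemma nullN u : null u -> null (- u).
Proof. by move=> u0; have := nullZD (-1) u0 null0; rewrite addr0 scaleN1r. Qed.

Lemma nullD u v : null u -> null v -> null (u + v).
Proof. by move=> u0 v0; have := nullZD 1 u0 v0; rewrite scale1r. Qed.

Definition cequiv (u v : cauchyseq) := `[< null (u - v) >].

Lemma cequiv_equiv : equiv_class_of cequiv.
Proof.
split.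
- by move=> u; apply/asboolP; rewrite subrr; exact: null0.
- move=> u v; apply/asboolP/asboolP => uv; rewrite -opprB; exact: nullN.
- move=> u v w /asboolP uv /asboolP vw; apply/asboolP.
  by rewrite -(subrK u v) -addrA; exact: nullD.
Qed.

Canonical cequiv_equivRel := EquivRelPack cequiv_equiv.

Local Open Scope quotient_scope.

Definition completion : Type := {eq_quot cequiv}.
HB.instance Definition _ := Choice.on completion.
HB.instance Definition _ := EqQuotient.on completion.

Implicit Types (u v : cauchyseq) (x y z : completion).

Definition cclass u : completion := \pi u.

Lemma cclassW (P : completion -> Prop) :
  (forall u, P (cclass u)) -> forall x, P x.
Proof. by move=> Pu; elim/quotW. Qed.

Lemma piP u v : cclass u = cclass v <-> null (u - v).
Proof.
split=> [/eqP|uv]; first by rewrite eqmodE => /asboolP.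
by apply/eqP; rewrite eqmodE; apply/asboolP.
Qed.

Lemma null_repr u : null (u - repr (cclass u)).
Proof. by apply/piP; rewrite /cclass reprK. Qed.

Let cadd x y := cclass (repr x + repr y).
Let copp x := cclass (- repr x).
Let cscale (a : R[i]) x := cclass (a *: repr x).

Let pi_add u v : cadd (cclass u) (cclass v) = cclass (u + v).
Proof.
apply/piP; rewrite opprD addrACA -opprB -[X in _ + X]opprB -opprD.
by apply/nullN/nullD; exact: null_repr.
Qed.

Let pi_opp u : copp (cclass u) = cclass (- u).
Proof. by apply/piP; rewrite opprK addrC; exact: null_repr. Qed.

Let pi_scale a u : cscale a (cclass u) = cclass (a *: u).
Proof.
apply/piP; rewrite -scalerBr -opprB scalerN -[_ *: _]addr0.
by apply/nullN/nullZD; [exact: null_repr|exact: null0].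
Qed.

Let caddA : associative cadd.
Proof.
by elim/cclassW => u; elim/cclassW => v; elim/cclassW => w; rewrite !pi_add addrA.
Qed.

Let caddC : commutative cadd.
Proof. by elim/cclassW => u; elim/cclassW => v; rewrite !pi_add addrC. Qed.

Let cadd0 : left_id (cclass 0) cadd.
Proof. by elim/cclassW => u; rewrite pi_add add0r. Qed.

Let caddN : left_inverse (cclass 0) copp cadd.
Proof. by elim/cclassW => u; rewrite pi_opp pi_add addNr. Qed.

HB.instance Definition _ :=
  GRing.isZmodule.Build completion caddA caddC cadd0 caddN.

Let piD u v : cclass u + cclass v = cclass (u + v).
Proof. exact: pi_add. Qed.

Let cscaleA a b x : cscale a (cscale b x) = cscale (a * b) x.
Proof. by elim/cclassW: x => u; rewrite !pi_scale scalerA. Qed.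

Let cscale1 : left_id 1 cscale.
Proof. by elim/cclassW => u; rewrite pi_scale scale1r. Qed.

Let cscaleDr : right_distributive cscale +%R.
Proof.
move=> a; elim/cclassW => u; elim/cclassW => v.
by rewrite !(piD, pi_scale) scalerDr.
Qed.

Let cscaleDl x : {morph cscale^~ x : a b / a + b >-> a + b}.
Proof. by elim/cclassW: x => u a b; rewrite !(piD, pi_scale) scalerDl. Qed.

HB.instance Definition _ := GRing.Zmodule_isLmodule.Build R[i] completion
  cscaleA cscale1 cscaleDr cscaleDl.

Lemma pi_linear : linear (cclass : cauchyseq -> completion).
Proof. by move=> a u v; rewrite -piD -pi_scale. Qed.

Lemma snorm_cvg u : cvg (p (u n) @[n --> \oo]).
Proof.
apply: real_cauchy_cvg => e e0.
have /asboolP /(_ e e0)[N HN] := cseqP u.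
by exists N => m n Nm Nn; rewrite (le_lt_trans (ler_dist_snorm _ _))// HN.
Qed.

Definition cnorm x : R := lim (p (repr x n) @[n --> \oo]).

Lemma cnorm_pi u : p (u n) @[n --> \oo] --> cnorm (cclass u).
Proof.
have uv := null_repr u; have uc := @snorm_cvg u.
suff -> : cnorm (cclass u) = lim (p (u n) @[n --> \oo]) by [].
apply/eqP; rewrite -subr_eq0 -normr_eq0 distrC; apply/eqP.
have vc := @snorm_cvg (repr (cclass u)).
apply: seq_lim_unique (cvg_norm (cvgB uc vc)) _.
apply: (squeeze_cvgr _ (cvg_cst 0) uv); near=> n.
by rewrite normr_ge0 /=; exact: ler_dist_snorm.
Unshelve. all: by end_near. Qed.

Let norm x : R[i] := (cnorm x)%:C.

Let norm_ler_normD x y : norm (x + y) <= norm x + norm y.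
Proof.
rewrite /norm -rmorphD lecR; elim/cclassW: x => u; elim/cclassW: y => v.
rewrite piD; have uc := @cnorm_pi u; have vc := @cnorm_pi v.
apply: ler_cvg_to (@cnorm_pi (u + v)) (cvgD uc vc) _.
by near=> n; exact: ler_snormD.
Unshelve. all: by end_near. Qed.

Let norm_normrZ (a : R[i]) x : norm (a *: x) = `|a| * norm x.
Proof.
rewrite /norm rnormE -rmorphM; congr (_%:C); elim/cclassW: x => u.
have -> : a *: cclass u = cclass (a *: u) by exact: pi_scale.
have uc := @cnorm_pi u.
have auc : p ((a *: u) n) @[n --> \oo] --> rnorm a * cnorm (cclass u).
  rewrite (_ : (fun n => _) = (fun n => rnorm a * p (u n))).
    exact: cvg_mul_cst.
  by apply/funext => n; exact: snormZ.
by apply: seq_lim_unique (@cnorm_pi (a *: u)) auc.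
Qed.

Let norm_normr0_eq0 x : norm x = 0 -> x = 0.
Proof.
elim/cclassW: x => u [u0]; apply/piP; rewrite subr0 /null -u0.
exact: cnorm_pi.
Qed.

HB.instance Definition _ := Lmodule_isNormed.Build R[i] completion
  norm_ler_normD norm_normrZ norm_normr0_eq0.

Lemma completion_rnormE x : rnorm x = cnorm x.
Proof. by []. Qed.

Lemma const_cauchy (a : V) : (fun=> a) \in cauchy_pred.
Proof.
by apply/asboolP => e e0; exists 0%N => m n _ _; rewrite subrr snorm0.
Qed.

Definition to_completion (a : V) : completion :=
  cclass (CauchySeq (const_cauchy a)).

Lemma to_completion_linear : linear to_completion.
Proof.
move=> a x y; rewrite -pi_linear; congr cclass; apply/val_inj.
exact/funext.
Qed.

HB.instance Definition _ :=
  GRing.isLinear.Build R[i] V completion *:%R to_completion to_completion_linear.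

Lemma rnorm_to_completion a : rnorm (to_completion a) = p a.
Proof.
apply: seq_lim_unique (cvg_cst (p a)) => //.
exact: (@cnorm_pi (CauchySeq (const_cauchy a))).
Qed.

Lemma to_completion_cvg u :
  rnorm (to_completion (u n) - cclass u) @[n --> \oo] --> (0 : R).
Proof.
apply/cvgrPdist_le => e e0.
have /asboolP /(_ e e0)[N HN] := cseqP u.
exists N => // n /= Nn; rewrite sub0r normrN ger0_norm ?rnorm_ge0//.
have -> : to_completion (u n) - cclass u =
    cclass (CauchySeq (const_cauchy (u n)) - u).
  by rewrite -scaleN1r addrC -pi_linear scaleN1r addrC.
rewrite completion_rnormE.
apply: ler_cvg_to (@cnorm_pi _) (cvg_cst e) _.
by exists N => // m /= Nm; apply/ltW/HN.
Qed.

Lemma to_completion_dense x (e : R) : 0 < e ->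
  exists a, rnorm (to_completion a - x) < e.
Proof.
elim/cclassW: x => u e0; have /cvgrPdist_lt/(_ _ e0)[N _ HN] := to_completion_cvg u.
exists (u N); have := HN N (leqnn N).
by rewrite /= sub0r normrN ger0_norm// rnorm_ge0.
Qed.

Lemma completion_complete (F : set_system completion) :
  ProperFilter F -> cauchy F -> cvg F.
Proof.
apply: seq_complete => x xc.
have Ha k : exists a, rnorm (to_completion a - x k) < k.+1%:R^-1.
  by apply: to_completion_dense; rewrite invr_gt0.
have [a aP] := choice Ha.
have acP : a \in cauchy_pred.
  apply/asboolP => e e0; have e40 : 0 < e / 2 / 2 by rewrite !divr_gt0.
  have [N1 _ H1] := near_infty_natSinv_lt (PosNum e40).
  have [N2 _ H2] := xc _ e40.
  pose N := maxn N1 N2; exists N => m n Nm Nn.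
  have aN k : (N <= k)%N -> rnorm (to_completion (a k) - x N) < e / 2.
    move=> Nk; rewrite -(subrK (x k) (to_completion _)) -addrA [e / 2]splitr.
    rewrite (le_lt_trans (ler_rnormD _ _))// ltrD//.
      by rewrite (lt_trans (aP k))// H1//= (leq_trans (leq_maxl _ N2)).
    by apply: H2 => //=; exact: leq_maxr.
  rewrite -rnorm_to_completion linearB /=.
  have -> : to_completion (a m) - to_completion (a n) =
      (to_completion (a m) - x N) - (to_completion (a n) - x N).
    by rewrite opprB addrA subrK.
  by rewrite [e]splitr (le_lt_trans (ler_rnormB _ _))// ltrD// aN.
exists (cclass (CauchySeq acP)).
have ac := to_completion_cvg (CauchySeq acP).
have inv0 : (n.+1%:R^-1 : R) @[n --> \oo] --> 0 by exact: cvg_harmonic.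
have := cvgD inv0 ac; rewrite addr0 => /(_ _)/(squeeze_cvgr _ (cvg_cst 0)); apply.
near=> n; rewrite rnorm_ge0 /=.
rewrite -(subrK (to_completion (a n)) (x n)) -addrA.
by rewrite (le_trans (ler_rnormD _ _))// lerD// rnormB ltW.
Unshelve. all: by end_near. Qed.

HB.instance Definition _ := Uniform_isComplete.Build completion completion_complete.

End Completion.

Section CompletionExtension.
Variables (R : realType) (V : lmodType R[i]) (p : seminorm V).
Variable Z : completeNormedModType R[i].

Lemma completion_ext (L : V -> Z) (M : R) : linear L ->
  (forall a, rnorm (L a) <= M * p a) ->
  exists2 L' : bop (completion p) Z, forall a, L' (to_completion p a) = L a &
    forall x, rnorm (L' x) <= M * rnorm x.
Proof.
move=> lL LM.
pose lf := GRing.isLinear.Build R[i] V Z *:%R L lL.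
pose Lf : {linear V -> Z} := HB.pack L lf.
have LB a b : L (a - b) = L a - L b := linearB Lf a b.
have Lc (u : cauchyseq p) : cvg (L (u n) @[n --> \oo]).
  apply: cauchy_seq_cvg => e e0.
  have M0 : 0 < `|M| + 1 by rewrite ltr_wpDl.
  have /asboolP/(_ (e / (`|M| + 1)))[|N HN] := cseqP u; first by rewrite divr_gt0.
  exists N => m n Nm Nn; have -> : L (u m) - L (u n) = L (u m - u n).
    by rewrite LB.
  rewrite (le_lt_trans (LM _))// (@le_lt_trans _ _ ((`|M| + 1) * p (u m - u n)))//.
    by rewrite ler_wpM2r ?snorm_ge0// (le_trans (ler_norm M))// lerDl.
  by rewrite mulrC -ltr_pdivlMr// HN.
pose L' (x : completion p) := lim (L (repr x n) @[n --> \oo]).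
have L'pi (u : cauchyseq p) : L (u n) @[n --> \oo] --> L' (cclass u).
  have -> : L' (cclass u) = lim (L (u n) @[n --> \oo]).
    apply/eqP; rewrite eq_sym -subr_eq0; apply/eqP/rnorm0_eq0.
    apply: seq_lim_unique (cvg_rnorm (cvgB (Lc u) (Lc (repr (cclass u))))) _.
    have := cvg_mul_cst M (null_repr u); rewrite mulr0 => h.
    apply: (squeeze_cvgr _ (cvg_cst 0) h); near=> n.
    by rewrite rnorm_ge0 /=; have := LM (u n - repr (cclass u) n); rewrite LB.
  exact: Lc.
have lL' : linear L'.
  move=> a; elim/cclassW => u; elim/cclassW => v; rewrite -pi_linear.
  have uc := L'pi u; have vc := L'pi v.
  have auv := cvgD (@cvgZr _ _ _ _ _ a _ _ uc) vc.
  apply: seq_lim_unique (L'pi (a *: u + v)) _.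
  have -> : (fun n => L ((a *: u + v) n)) = (fun n => a *: L (u n) + L (v n)).
    by apply/funext => n; exact: (linearP Lf).
  exact: auv.
have L'M x : rnorm (L' x) <= M * rnorm x.
  elim/cclassW: x => u; have uc := cvg_rnorm (L'pi u).
  have pc := cvg_mul_cst M (@cnorm_pi _ _ p u).
  by apply: ler_cvg_to uc pc _; near=> n; exact: LM.
exists (mkbop lL' L'M) => // a.
have := L'pi (CauchySeq (const_cauchy p a)) => /=.
by move/seq_lim_unique; apply; exact: cvg_cst.
Unshelve. all: by end_near. Qed.

End CompletionExtension.

Section SeparatingFunctional.
Variables (K : fieldType) (Z : lmodType K).

Lemma separating_functional (z : Z) : z != 0 ->
  exists2 f : Z -> K^o, linear f & f z != 0.
Proof.
move=> z0.
pose P := [set H : set Z |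
  (forall (a : K) x y, H x -> H y -> H (a *: x + y)) /\ ~ H z].
have [F FP Ftot|A [[Alin Az] Amax]] := @Zorn_bigcup Z P.
  split=> [a x y [H FH Hx] [G FG Gy]|[H /FP[_ Hz] /Hz]//].
  have [HG|GH] := Ftot _ _ FH FG.
    by exists G => //; apply: (FP _ FG).1 => //; exact: HG.
  by exists H => //; apply: (FP _ FH).1 => //; exact: GH.
have A0 : A 0.
  apply: contrapT => A0; apply: (Amax [set 0]).
    split; last by move=> /(_ 0 erefl).
    move=> x Ax; exfalso; apply: A0.
    by rewrite -(addNr x) -scaleN1r; exact: Alin.
  split=> [a x y -> ->|/esym/eqP]; first by rewrite scaler0 addr0.
  by rewrite eq_sym (negbTE z0).
have AZ a x : A x -> A (a *: x).
  by move=> Ax; rewrite -[_ *: _]addr0; exact: Alin.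
have AD x y : A x -> A y -> A (x + y).
  by move=> Ax Ay; rewrite -[x]scale1r; exact: Alin.
have ex v : exists l, A (v - l *: z).
  have [Av|nAv] := pselect (A v); first by exists 0; rewrite scale0r subr0.
  pose B := [set h + c *: v | h in A & c in [set: K]].
  have nPB : ~ P B.
    apply: Amax; split.
      by move=> h Ah; exists h => //; exists 0 => //; rewrite scale0r addr0.
    by move=> /(_ v) BA; apply/nAv/BA; exists 0 => //; exists 1; rewrite // add0r scale1r.
  have [h Ah [c _ hcz]] : B z.
    apply: contrapT => nBz; apply: nPB; split=> // a x y.
    move=> [h Ah [c _ <-]] [h' Ah' [c' _ <-]].
    exists (a *: h + h'); first exact: Alin.
    exists (a * c + c') => //.
    by rewrite scalerDr scalerDl addrACA scalerA.
  have c0 : c != 0.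
    by apply/eqP => c0; apply: Az; rewrite -hcz c0 scale0r addr0.
  exists c^-1; rewrite -hcz scalerDr scalerK// opprD addrC -addrA addNr addr0.
  by rewrite -scaleNr; exact: AZ.
have [f fP] := choice ex.
have funiq v l : A (v - l *: z) -> f v = l.
  move=> Al; apply/eqP; rewrite -subr_eq0; apply: contrapT => /negP fl.
  apply: Az; rewrite -[z](scalerK fl); apply: AZ.
  have -> : (f v - l) *: z = -1 *: (v - f v *: z) + (v - l *: z).
    by rewrite scaleN1r opprB scalerBl addrA subrK.
  exact: Alin.
exists f => [a x y|].
  apply: funiq; rewrite scalerDl -scalerA opprD addrACA -scalerBr.
  exact: Alin.
by rewrite (funiq z 1) ?oner_eq0// scale1r subrr.
Qed.

End SeparatingFunctional.

Definition bilinear_map (K : nzRingType) (X Y Z : lmodType K) (B : X -> Y -> Z) :=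
  (forall y, linear (B^~ y)) /\ (forall x, linear (B x)).

(* The algebraic tensor product of [X] and [Y], as the space of those
   functionals on the bilinear forms on [X * Y] that are finite sums of
   evaluations [B |-> B x y]; by [tensor_sum_bilinear] below, it has the
   universal property for bilinear maps into any module. *)
Section AlgebraicTensor.
Variables (K : fieldType) (X Y : lmodType K).

Record bilform :=
  BilForm { bform :> X -> Y -> K^o ; bformP : bilinear_map bform }.

Definition tensor_sum (s : seq (X * Y)) : bilform -> K^o :=
  fun B => \sum_(z <- s) B z.1 z.2.

Definition tensor_pred : {pred bilform -> K^o} :=
  fun u => `[< exists s, u = tensor_sum s >].

Record atensor :=
  ATensor { atensor_fun :> bilform -> K^o ; _ : atensor_fun \in tensor_pred }.

HB.instance Definition _ := [isSub for atensor_fun].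
HB.instance Definition _ := [Choice of atensor by <:].

Definition scale_rep (a : K) (s : seq (X * Y)) := [seq (a *: z.1, z.2) | z <- s].

Lemma tensor_sum_cat s t : tensor_sum (s ++ t) = tensor_sum s + tensor_sum t.
Proof. by apply/funext => B; rewrite /tensor_sum big_cat. Qed.

Lemma tensor_sum_scale a s : tensor_sum (scale_rep a s) = a *: tensor_sum s.
Proof.
apply/funext => B; rewrite /tensor_sum big_map /=.
change (\sum_(j <- s) B (a *: j.1) j.2 = a *: \sum_(z <- s) B z.1 z.2).
rewrite scaler_sumr; apply: eq_bigr => z _.
have [Bl _] := bformP B; have := Bl z.2 a z.1 0; rewrite !addr0 => ->.
by have := Bl z.2 1 0 0; rewrite scale1r addr0 scale1r -[LHS]addr0 => /addrI <-; rewrite addr0.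
Qed.

Lemma tensor_submod : submod_closed tensor_pred.
Proof.
split; first by apply/asboolP; exists [::]; apply/funext => B; rewrite /tensor_sum big_nil.
move=> a _ _ /asboolP[s ->] /asboolP[t ->]; apply/asboolP.
by exists (scale_rep a s ++ t); rewrite tensor_sum_cat tensor_sum_scale.
Qed.

HB.instance Definition _ :=
  GRing.isSubmodClosed.Build _ _ tensor_pred tensor_submod.
HB.instance Definition _ := [SubChoice_isSubLmodule of atensor by <:].

Lemma atensor_rep (u : atensor) : exists s, val u = tensor_sum s.
Proof. by case: u => u /= /asboolP. Qed.

Lemma tensor_sum_in s : tensor_sum s \in tensor_pred.
Proof. by apply/asboolP; exists s. Qed.

Definition atensor_of s : atensor := ATensor (tensor_sum_in s).

Lemma tensor_sum_bilinear (Z : lmodType K) (B : X -> Y -> Z) s t :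
  bilinear_map B -> tensor_sum s = tensor_sum t ->
  \sum_(z <- s) B z.1 z.2 = \sum_(z <- t) B z.1 z.2.
Proof.
move=> [Bl Br] st; apply/eqP; rewrite -subr_eq0; apply: contrapT => /negP.
move=> /separating_functional[f lf] /negP; apply; apply/eqP.
pose ff : {linear Z -> K^o} := HB.pack f (GRing.isLinear.Build K Z K^o *:%R f lf).
have Bf : bilinear_map (fun x y => f (B x y)).
  split=> [y a x x'|x a y y'] /=; first by rewrite Bl; exact: (linearP ff).
  by rewrite Br; exact: (linearP ff).
have := congr1 (fun g => g (BilForm Bf)) st; rewrite /tensor_sum /= => fst.
have fB a b : f (a - b) = f a - f b := linearB ff a b.
have fS r : f (\sum_(z <- r) B z.1 z.2) = \sum_(z <- r) f (B z.1 z.2).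
  exact: (linear_sum ff).
by rewrite fB !fS fst subrr.
Qed.

End AlgebraicTensor.

Section ProjectiveTensor.
Variables (R : realType) (X Y : normedModType R[i]).
Implicit Types (s t : seq (X * Y)) (u v : atensor X Y).

Definition cost s : R := \sum_(z <- s) rnorm z.1 * rnorm z.2.

Definition pnorm u : R :=
  inf [set cost s | s in [set s | val u = tensor_sum s]].

Lemma cost_ge0 s : 0 <= cost s.
Proof. by apply: sumr_ge0 => z _; rewrite mulr_ge0 ?rnorm_ge0. Qed.

Let cost_has_inf u : has_inf [set cost s | s in [set s | val u = tensor_sum s]].
Proof.
split; first by have [s us] := atensor_rep u; exists (cost s), s.
by exists 0 => _ [s _ <-]; exact: cost_ge0.
Qed.

Lemma pnorm_ge0 u : 0 <= pnorm u.
Proof.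
by apply: lb_le_inf; [case: (cost_has_inf u)|move=> _ [s _ <-]; exact: cost_ge0].
Qed.

Lemma pnorm_le u s : val u = tensor_sum s -> pnorm u <= cost s.
Proof. by move=> us; apply: ge_inf; [case: (cost_has_inf u)|exists s]. Qed.

Lemma pnorm_adherent u (e : R) : 0 < e ->
  exists2 s, val u = tensor_sum s & cost s < pnorm u + e.
Proof.
move=> e0; have [_ [s us <-]] := inf_adherent e0 (cost_has_inf u).
by exists s.
Qed.

Lemma pnormD u v : pnorm (u + v) <= pnorm u + pnorm v.
Proof.
apply/ler_addgt0Pr => e e0; have e20 : 0 < e / 2 by rewrite divr_gt0.
have [s us sl] := pnorm_adherent u e20.
have [t vt tl] := pnorm_adherent v e20.
have /pnorm_le/le_trans : val (u + v) = tensor_sum (s ++ t).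
  by rewrite tensor_sum_cat -us -vt.
apply; rewrite /cost big_cat /= [e]splitr addrACA.
by rewrite lerD// ltW.
Qed.

Let pnormZ_le (a : R[i]) u : pnorm (a *: u) <= rnorm a * pnorm u.
Proof.
have na : 0 < rnorm a + 1 by rewrite ltr_wpDl ?rnorm_ge0.
apply/ler_addgt0Pr => e e0.
have [s us sl] := pnorm_adherent u (divr_gt0 e0 na).
have /pnorm_le/le_trans : val (a *: u) = tensor_sum (scale_rep a s).
  by rewrite tensor_sum_scale -us.
apply; have -> : cost (scale_rep a s) = rnorm a * cost s.
  rewrite /cost big_map mulr_sumr; apply: eq_bigr => z _ /=.
  by rewrite rnormZ mulrA.
apply: (@le_trans _ _ (rnorm a * (pnorm u + e / (rnorm a + 1)))).
  by rewrite ler_wpM2l ?rnorm_ge0// ltW.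
rewrite mulrDr lerD2l mulrCA ger_pMr// ler_pdivrMr// mul1r lerDl//.
Qed.

Lemma pnormZ (a : R[i]) u : pnorm (a *: u) = rnorm a * pnorm u.
Proof.
apply/eqP; rewrite eq_le pnormZ_le andTb.
have [->|a0] := eqVneq a 0; first by rewrite rnorm0 mul0r pnorm_ge0.
have na : 0 < rnorm a.
  by rewrite lt0r rnorm_ge0 andbT; apply: contra_neq a0; exact: rnorm0_eq0.
rewrite -ler_pdivlMl// -{1}[u](scalerK a0) (le_trans (pnormZ_le _ _))//.
rewrite ler_wpM2r ?pnorm_ge0// -[leRHS]mul1r ler_pdivlMr//.
by rewrite -rnormM mulVf// rnormC normr1.
Qed.

Definition pseminorm : seminorm (atensor X Y) := Seminorm pnormD pnormZ.

(* The completion of the algebraic tensor product for the projective norm. *)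
Definition ptensor : completeNormedModType R[i] := completion pseminorm.

Definition tens (x : X) (y : Y) : ptensor :=
  to_completion pseminorm (atensor_of [:: (x, y)]).

Lemma tens_bilinear : bilinear_map tens.
Proof.
have T1 B x y : tensor_sum [:: (x, y)] B = B x y by rewrite /tensor_sum big_seq1.
split=> [y a x x'|x a y y']; rewrite /tens -to_completion_linear;
  congr to_completion; apply/val_inj/funext => B.
- change (tensor_sum [:: (a *: x + x', y)] B =
    a *: tensor_sum [:: (x, y)] B + tensor_sum [:: (x', y)] B).
  by rewrite !T1; case: (bformP B) => Bl _; exact: Bl.
- change (tensor_sum [:: (x, a *: y + y')] B =
    a *: tensor_sum [:: (x, y)] B + tensor_sum [:: (x, y')] B).
  by rewrite !T1; case: (bformP B) => _ Br; exact: Br.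
Qed.

Lemma rnorm_tens_le x y : rnorm (tens x y) <= rnorm x * rnorm y.
Proof.
by rewrite rnorm_to_completion (le_trans (@pnorm_le _ [:: (x, y)] _))// /cost big_seq1.
Qed.

Lemma ptensor_dense (x : ptensor) (e : R) : 0 < e ->
  exists s, rnorm (\sum_(z <- s) tens z.1 z.2 - x) < e.
Proof.
move=> e0; have [u uP] := to_completion_dense x e0.
have [s us] := atensor_rep u; exists s.
suff -> : \sum_(z <- s) tens z.1 z.2 = to_completion pseminorm u by [].
rewrite -linear_sum; congr to_completion; apply/val_inj; rewrite us.
elim: s {us} => [|[x' y'] s IH].
  by rewrite big_nil; apply/funext => B; rewrite /tensor_sum big_nil.
by rewrite big_cons -[(x', y') :: s]/([:: (x', y')] ++ s) tensor_sum_cat -IH.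
Qed.

End ProjectiveTensor.

Definition bounded_bilinear (R : realType) (X Y Z : normedModType R[i])
    (B : X -> Y -> Z) :=
  bilinear_map B /\
  exists M : R, forall x y, rnorm (B x y) <= M * (rnorm x * rnorm y).

Section Lift.
Variables (R : realType) (X Y : normedModType R[i]).
Variable Z : completeNormedModType R[i].

Lemma ptensor_lift_bounded (B : X -> Y -> Z) (M : R) : bilinear_map B -> 0 <= M ->
  (forall x y, rnorm (B x y) <= M * (rnorm x * rnorm y)) ->
  exists2 L : bop (ptensor X Y) Z, forall x y, L (tens x y) = B x y &
    rnorm L <= M.
Proof.
move=> Bb M0 BM.
have [r rP] := choice (@atensor_rep _ X Y).
pose L0 (u : atensor X Y) := \sum_(z <- r u) B z.1 z.2.
have L0E u s : val u = tensor_sum s -> L0 u = \sum_(z <- s) B z.1 z.2.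
  by move=> us; apply: tensor_sum_bilinear => //; rewrite -rP.
have L0l : linear L0.
  move=> a u v.
  rewrite (L0E (a *: u + v) (scale_rep a (r u) ++ r v)); last first.
    by rewrite tensor_sum_cat tensor_sum_scale -!rP.
  rewrite big_cat big_map /=; congr (_ + _).
  rewrite /L0 scaler_sumr; apply: eq_bigr => z _ /=.
  have [Bl _] := Bb; have B0 y : B 0 y = 0.
    have := Bl y 1 0 0; rewrite /= !scale1r addr0 -[LHS]addr0.
    by move/addrI.
  by have := Bl z.2 a z.1 0; rewrite /= !addr0 B0 addr0.
have [|L LE LM] := @completion_ext R _ (pseminorm X Y) Z L0 M L0l.
  move=> u; apply/ler_addgt0Pr => e e0.
  have M1 : 0 < M + 1 by rewrite ltr_wpDl.
  have [s us sl] := pnorm_adherent u (divr_gt0 e0 M1).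
  rewrite (L0E _ _ us).
  apply: (@le_trans _ _ (M * cost s)).
    rewrite /cost; elim: s {us sl} => [|z s IH].
      by rewrite !big_nil rnorm0 mulr0.
    by rewrite !big_cons mulrDr (le_trans (ler_rnormD _ _))// lerD.
  apply: (@le_trans _ _ (M * (pnorm u + e / (M + 1)))).
    by rewrite ler_wpM2l// ltW.
  by rewrite mulrDr lerD2l mulrCA ger_pMr// ler_pdivrMr// mul1r lerDl.
exists L; last by rewrite bop_rnormE; exact: opnorm_le.
by move=> x y; rewrite LE (L0E _ [:: (x, y)])// big_seq1.
Qed.

Lemma ptensor_ext (L L' : bop (ptensor X Y) Z) :
  (forall x y, L (tens x y) = L' (tens x y)) -> L = L'.
Proof.
move=> LL; apply/bopP => x; apply/eqP; rewrite -subr_eq0; apply/eqP.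
apply: rnorm0_eq0; apply/eqP; rewrite eq_le rnorm_ge0 andbT.
apply/ler_addgt0Pr => e e0; rewrite add0r.
pose D := L - L'; have DE v : D v = L v - L' v by [].
have D0 y z : D (tens y z) = 0 by rewrite DE LL subrr.
rewrite -DE.
have D1 : 0 < rnorm D + 1 by rewrite ltr_wpDl ?rnorm_ge0.
have [s sx] := ptensor_dense x (divr_gt0 e0 D1).
have DB a b : D (a - b) = D a - D b := linearB D a b.
have Ds : D (\sum_(z <- s) tens z.1 z.2) = 0.
  by rewrite linear_sum /=; apply: big1 => z _; exact: D0.
have -> : D x = - D (\sum_(z <- s) tens z.1 z.2 - x).
  by rewrite DB Ds sub0r opprK.
rewrite rnormN (le_trans (opnormP _ _))//.
apply: (@le_trans _ _ ((rnorm D + 1) * (e / (rnorm D + 1)))).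
  by apply: ler_pM; rewrite ?opnorm_ge0 ?rnorm_ge0 ?lerDl// ltW.
by rewrite mulrC divfK// gt_eqF.
Qed.

Lemma ptensor_lift_ex (B : X -> Y -> Z) : bounded_bilinear B ->
  exists L : bop (ptensor X Y) Z, forall x y, L (tens x y) = B x y.
Proof.
move=> [Bb [M BM]].
have [|x y|L LB _] := @ptensor_lift_bounded B `|M| Bb => //.
  by rewrite (le_trans (BM _ _))// ler_wpM2r ?ler_norm// mulr_ge0 ?rnorm_ge0.
by exists L.
Qed.

Definition ptensor_lift (B : X -> Y -> Z) (HB : bounded_bilinear B) :
  bop (ptensor X Y) Z := projT1 (cid (ptensor_lift_ex HB)).

Lemma ptensor_liftE (B : X -> Y -> Z) (HB : bounded_bilinear B) x y :
  ptensor_lift HB (tens x y) = B x y.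
Proof. by rewrite /ptensor_lift; case: cid. Qed.

End Lift.

Section Duality.
Variable R : realType.
Implicit Types V W : normedModType R[i].

Definition dual V : normedModType R[i] := bop V R[i]^o.

Definition bidual V : normedModType R[i] := dual (dual V).

Lemma comp_bop_pred U V W (g : bop V W) (f : bop U V) :
  g \o f \in @bop_pred R U W.
Proof.
apply: (@bounded_bop_pred _ _ _ _ (rnorm g * rnorm f)) => [a x y|x] /=.
  by rewrite (bop_linear f) (bop_linear g).
rewrite (le_trans (ler_rnorm_bop g _))// -mulrA ler_wpM2l ?rnorm_ge0//.
exact: (ler_rnorm_bop f x).
Qed.

Definition bop_comp U V W (g : bop V W) (f : bop U V) : bop U W :=
  Bop (comp_bop_pred g f).

Lemma adj_bop_pred V W (T : bop V W) :
  (fun f : dual W => bop_comp f T : dual V) \in @bop_pred R (dual W) (dual V).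
Proof.
apply: (@bounded_bop_pred _ _ _ _ (rnorm T)) => [a f g|f]; first exact: bopP.
apply: opnorm_le => [|x]; first by rewrite mulr_ge0 ?rnorm_ge0.
rewrite [_ * rnorm f]mulrC -mulrA (le_trans (ler_rnorm_bop f _))//.
by rewrite ler_wpM2l ?rnorm_ge0//; exact: (ler_rnorm_bop T x).
Qed.

Definition adj V W (T : bop V W) : bop (dual W) (dual V) := Bop (adj_bop_pred T).

Lemma evalb_bop_pred V (x : V) :
  (fun f : dual V => f x : R[i]^o) \in @bop_pred R (dual V) R[i]^o.
Proof.
apply: (@bounded_bop_pred _ _ _ _ (rnorm x)) => [a f g //|f].
by rewrite mulrC; exact: (ler_rnorm_bop f x).
Qed.

Definition to_bidual V (x : V) : bidual V := Bop (evalb_bop_pred x).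

End Duality.

(* Banach algebras, not assumed unital. *)
HB.mixin Record isBanachAlgebra (K : numFieldType) A
    & CompleteNormedModule K A := {
  bmul : A -> A -> A ;
  bmulA : associative bmul ;
  bmul_bilinear : bilinear_map bmul ;
  ler_norm_bmul : forall x y : A, `|bmul x y| <= `|x| * `|y| }.

#[short(type="banachAlgType")]
HB.structure Definition BanachAlgebra (K : numFieldType) :=
  {A of CompleteNormedModule K A & isBanachAlgebra K A}.

Section Amenability.
Variables (R : realType) (A : banachAlgType R[i]).
Implicit Types a x y : A.

Lemma ler_rnorm_bmul x y : rnorm (bmul x y) <= rnorm x * rnorm y.
Proof. by rewrite -lecR rmorphM/= -!rnormE ler_norm_bmul. Qed.

Definition lmul a : bop A A :=
  mkbop ((@bmul_bilinear _ A).2 a) (ler_rnorm_bmul a).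

Lemma rmul_subproof a x : rnorm (bmul x a) <= rnorm a * rnorm x.
Proof. by rewrite mulrC ler_rnorm_bmul. Qed.

Definition rmul a : bop A A :=
  mkbop ((@bmul_bilinear _ A).1 a) (rmul_subproof a).

Local Notation AA := (ptensor A A).

Lemma ltens_subproof a : bounded_bilinear (fun x y => tens (bmul a x) y : AA).
Proof.
split; first split=> [y b x x'|x b y y'].
- have /= -> : bmul a (b *: x + x') = b *: bmul a x + bmul a x'.
    exact: bop_linear (lmul a) b x x'.
  exact: (tens_bilinear A A).1.
- exact: (tens_bilinear A A).2.
exists (rnorm a) => x y; rewrite (le_trans (rnorm_tens_le _ _))// mulrA.
by rewrite ler_wpM2r ?rnorm_ge0// ler_rnorm_bmul.
Qed.

Definition ltens a : bop AA AA := ptensor_lift (ltens_subproof a).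

Lemma ltensE a x y : ltens a (tens x y) = tens (bmul a x) y.
Proof. exact: ptensor_liftE. Qed.

Lemma rtens_subproof a : bounded_bilinear (fun x y => tens x (bmul y a) : AA).
Proof.
split; first split=> [y b x x'|x b y y'].
- exact: (tens_bilinear A A).1.
- have /= -> : bmul (b *: y + y') a = b *: bmul y a + bmul y' a.
    exact: bop_linear (rmul a) b y y'.
  exact: (tens_bilinear A A).2.
exists (rnorm a) => x y; rewrite (le_trans (rnorm_tens_le _ _))// mulrCA.
by rewrite ler_wpM2l ?rnorm_ge0// mulrC ler_rnorm_bmul.
Qed.

Definition rtens a : bop AA AA := ptensor_lift (rtens_subproof a).

Lemma rtensE a x y : rtens a (tens x y) = tens x (bmul y a).
Proof. exact: ptensor_liftE. Qed.

Lemma product_subproof : bounded_bilinear (@bmul _ A).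
Proof.
split; first exact: bmul_bilinear.
by exists 1 => x y; rewrite mul1r ler_rnorm_bmul.
Qed.

Definition product_map : bop AA A := ptensor_lift product_subproof.

Lemma product_mapE x y : product_map (tens x y) = bmul x y.
Proof. exact: ptensor_liftE. Qed.

(* On a bidual, [a . M] and [M . a] are the second adjoints of the left and
   right actions of [a], applied to [M]. *)
Definition virtual_diagonal (M : bidual AA) : Prop :=
  (forall a, adj (adj (ltens a)) M = adj (adj (rtens a)) M) /\
  (forall a, let piM : bidual A := adj (adj product_map) M in
     adj (adj (lmul a)) piM = to_bidual a /\
     adj (adj (rmul a)) piM = to_bidual a).

Definition amenable : Prop := exists M, virtual_diagonal M.

(* The infimum of the empty set is [+oo]. *)
Definition AM : \bar R :=
  ereal_inf [set (rnorm M)%:E | M in [set M | virtual_diagonal M]].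

End Amenability.

Section SequenceLattice.
Variables (R : realType) (I : choiceType).
Implicit Types (E : set (I -> R[i])) (N : (I -> R[i]) -> R) (x y : I -> R[i]).

(* [E] with the norm [N] is a Banach space; the values of [N] outside [E] are
   irrelevant. *)
Record banach_function_space E N : Prop := {
  bfs0 : E 0 ;
  bfs_lin : forall (a : R[i]) x y, E x -> E y -> E (a *: x + y) ;
  bfs_normD : forall x y, E x -> E y -> N (x + y) <= N x + N y ;
  bfs_normZ : forall (a : R[i]) x, E x -> N (a *: x) = rnorm a * N x ;
  bfs_norm0_eq0 : forall x, E x -> N x = 0 -> x = 0 ;
  bfs_complete : forall u : nat -> I -> R[i], (forall n, E (u n)) ->
    (forall e, 0 < e -> exists k, forall m n, (k <= m)%N -> (k <= n)%N ->
       N (u m - u n) < e) ->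
    exists2 l, E l & N (u n - l) @[n --> \oo] --> (0 : R) }.

Definition c00 : set (I -> R[i]) := [set x | finite_set [set i | x i != 0]].

Definition linfty : set (I -> R[i]) :=
  [set x | has_ubound (range (fun i => rnorm (x i)))].

Definition linfty_norm x : R := sup (range (fun i => rnorm (x i))).

Record banach_sequence_lattice E N : Prop := {
  bsl_banach :> banach_function_space E N ;
  bsl_c00 : c00 `<=` E ;
  bsl_linfty : E `<=` linfty ;
  bsl_dense : forall x, E x -> forall e : R, 0 < e ->
    exists2 y, c00 y & N (x - y) < e ;
  bsl_solid : forall x y, E y -> linfty x ->
    (forall i, rnorm (x i) <= rnorm (y i)) -> E x /\ N x <= N y ;
  bsl_linfty_norm : forall x, E x -> linfty_norm x <= N x }.

Definition chi (F : {fset I}) : I -> R[i] := fun i => (i \in F)%:R.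

(* [C_E], the supremum of the norms of characteristic functions of finite
   sets. *)
Definition lattice_const N : \bar R :=
  ereal_sup (range (fun F : {fset I} => (N (chi F))%:E)).

Definition c0w (w : I -> R) : set (I -> R[i]) :=
  [set x | forall e : R, 0 < e -> finite_set [set i | e <= w i * rnorm (x i)]].

Definition c0w_norm (w : I -> R) x : R := sup (range (fun i => w i * rnorm (x i))).

End SequenceLattice.

Section LatticeTheory.
Variables (R : realType) (I : choiceType).
Variables (E : set (I -> R[i])) (N : (I -> R[i]) -> R).
Hypothesis HE : banach_sequence_lattice E N.
Implicit Types x y : I -> R[i].

Lemma bsl_le x y : E y -> (forall i, rnorm (x i) <= rnorm (y i)) ->
  E x /\ N x <= N y.
Proof.
move=> Ey xy; apply: (bsl_solid HE Ey) => //.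
have [M My] := bsl_linfty HE Ey; exists M => _ [i _ <-].
by rewrite (le_trans (xy i))//; apply: My; exists i.
Qed.

Lemma bslD x y : E x -> E y -> E (x + y).
Proof. by move=> Ex Ey; have := bfs_lin HE 1 Ex Ey; rewrite scale1r. Qed.

Lemma bslZ (a : R[i]) x : E x -> E (a *: x).
Proof. by move=> Ex; have := bfs_lin HE a Ex (bfs0 HE); rewrite addr0. Qed.

Lemma bslB x y : E x -> E y -> E (x - y).
Proof. by move=> Ex Ey; rewrite -scaleN1r; apply/bslD/bslZ. Qed.

Lemma bsl_norm_distr x y : E x -> E y -> N (x - y) = N (y - x).
Proof.
move=> Ex Ey; rewrite -opprB -scaleN1r (bfs_normZ HE); last exact: bslB.
by rewrite rnormN rnormC normr1 mul1r.
Qed.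

Lemma bsl_norm0 : N 0 = 0.
Proof. by have := bfs_normZ HE 0 (bfs0 HE); rewrite scale0r rnorm0 mul0r. Qed.

Lemma bsl_coord x i : E x -> rnorm (x i) <= N x.
Proof.
move=> Ex; apply: le_trans (bsl_linfty_norm HE Ex).
have [M xM] := bsl_linfty HE Ex.
by apply: sup_upper_bound; [split; [exists (rnorm (x i)), i|exists M]|exists i].
Qed.

Lemma bsl_norm_ge0 x : E x -> 0 <= N x.
Proof.
move=> Ex; have := bfs_normD HE Ex (bslZ (-1) Ex).
rewrite scaleN1r subrr bsl_norm0 -scaleN1r (bfs_normZ HE)//.
by rewrite rnormN rnormC normr1 mul1r -mulr2n pmulrn_lge0.
Qed.

Lemma bsl_limit (u : nat -> I -> R[i]) (l : I -> R[i]) : (forall n, E (u n)) ->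
  (forall e, 0 < e -> exists k, forall m n, (k <= m)%N -> (k <= n)%N ->
     N (u m - u n) < e) ->
  (forall i, rnorm (u n i - l i) @[n --> \oo] --> (0 : R)) ->
  E l /\ N (u n - l) @[n --> \oo] --> (0 : R).
Proof.
move=> Eu uc ul; have [l' El' ul'] := bfs_complete HE Eu uc.
suff -> : l = l' by [].
apply/funext => i; apply/eqP; rewrite -subr_eq0; apply/eqP/rnorm0_eq0.
apply/eqP; rewrite eq_le rnorm_ge0 andbT.
have h : N (u n - l') + rnorm (u n i - l i) @[n --> \oo] --> (0 : R).
  by have := cvgD ul' (ul i); rewrite addr0; apply.
apply: ler_cvg_to (cvg_cst (rnorm (l i - l' i))) h _.
near=> n.
have -> : l i - l' i = (u n i - l' i) - (u n i - l i).
  by rewrite opprB [RHS]addrC subrKA.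
rewrite (le_trans (ler_rnormB _ _))// lerD//.
exact: (@bsl_coord (u n - l') i (bslB (Eu n) El')).
Unshelve. all: by end_near. Qed.

End LatticeTheory.

Definition esum_pred (R : realType) (I : choiceType) (E : set (I -> R[i]))
    (A : I -> banachAlgType R[i]) : {pred (forall i, A i)} :=
  fun a => `[< E (fun i => `|a i|) >].

Arguments esum_pred {R I} E A _ : assert.

(* The [E]-sum of the family [A]. The argument of type
   [banach_sequence_lattice E N] carries the norm and the proofs that the
   instances below need. *)
Record esum (R : realType) (I : choiceType) (E : set (I -> R[i]))
    (N : (I -> R[i]) -> R) (HE : banach_sequence_lattice E N)
    (A : I -> banachAlgType R[i]) :=
  ESum { coord :> forall i, A i ; coordP : coord \in esum_pred E A }.

Section ESum.
Variables (R : realType) (I : choiceType).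
Variables (E : set (I -> R[i])) (N : (I -> R[i]) -> R).
Variable HE : banach_sequence_lattice E N.
Variable A : I -> banachAlgType R[i].

Local Notation esum := (esum HE A).
Local Notation esum_pred := (esum_pred E A).
Local Notation ESum := (@ESum R I E N HE A _).

HB.instance Definition _ := [isSub of esum for @coord R I E N HE A].
HB.instance Definition _ := [Choice of esum by <:].

Implicit Types a b c : esum.

Definition esum_norm a : R := N (fun i => `|a i|).

Lemma esumE a : E (fun i => `|a i|).
Proof. by case: a => a /= /asboolP. Qed.

Lemma esumP a b : (forall i, a i = b i) -> a = b.
Proof. by move=> ab; apply/val_inj/functional_extensionality_dep. Qed.

Lemma esum_le (f : forall i, A i) x : E x ->
  (forall i, rnorm (f i) <= rnorm (x i)) ->
  f \in esum_pred /\ N (fun i => `|f i|) <= N x.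
Proof.
move=> Ex fx; have [|? ?] := @bsl_le _ _ _ _ HE (fun i => `|f i|) x Ex.
  by move=> i; rewrite rnorm_norm; exact: fx.
by split=> //; apply/asboolP.
Qed.

Let rnormDE a b i :
  rnorm (((fun i => `|a i|) + (fun i => `|b i|) : I -> R[i]) i) =
  rnorm (a i) + rnorm (b i).
Proof.
by rewrite !fctE !rnormE -rmorphD rnormC ger0_norm// addr_ge0 ?rnorm_ge0.
Qed.

Lemma esum_add_subproof a b : (fun i => a i + b i) \in esum_pred.
Proof.
apply: (esum_le (bslD HE (esumE a) (esumE b)) _).1 => i.
by rewrite rnormDE ler_rnormD.
Qed.

Lemma esum_scale_subproof (k : R[i]) a : (fun i => k *: a i) \in esum_pred.
Proof.
apply: (esum_le (bslZ HE k (esumE a)) _).1 => i.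
by rewrite !fctE rnormZ rnormM rnorm_norm.
Qed.

Lemma esum_opp_subproof a : (fun i => - a i) \in esum_pred.
Proof. by apply: (esum_le (esumE a) _).1 => i; rewrite rnormN rnorm_norm. Qed.

Lemma esum_zero_subproof : (fun i => 0 : A i) \in esum_pred.
Proof. by apply: (esum_le (bfs0 HE) _).1 => i; rewrite rnorm0 rnorm0. Qed.

Lemma esum_mul_subproof a b : (fun i => bmul (a i) (b i)) \in esum_pred.
Proof.
apply: (esum_le (bslZ HE (esum_norm a)%:C (esumE b)) _).1 => i.
rewrite !fctE rnormM rnorm_norm rnormC (le_trans (ler_rnorm_bmul _ _))//.
rewrite ler_wpM2r ?rnorm_ge0// (le_trans _ (ler_norm _))//.
by have := bsl_coord HE i (esumE a); rewrite rnorm_norm.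
Qed.

Definition esum_add a b := ESum (esum_add_subproof a b).
Definition esum_scale (k : R[i]) a := ESum (esum_scale_subproof k a).
Definition esum_opp a := ESum (esum_opp_subproof a).
Definition esum_zero := ESum esum_zero_subproof.
Definition esum_mul a b := ESum (esum_mul_subproof a b).

Let esum_addA : associative esum_add.
Proof. by move=> a b c; apply: esumP => i; exact: addrA. Qed.

Let esum_addC : commutative esum_add.
Proof. by move=> a b; apply: esumP => i; exact: addrC. Qed.

Let esum_add0 : left_id esum_zero esum_add.
Proof. by move=> a; apply: esumP => i; exact: add0r. Qed.

Let esum_addN : left_inverse esum_zero esum_opp esum_add.
Proof. by move=> a; apply: esumP => i; exact: addNr. Qed.

HB.instance Definition _ :=
  GRing.isZmodule.Build esum esum_addA esum_addC esum_add0 esum_addN.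

Let esum_scaleA k l a : esum_scale k (esum_scale l a) = esum_scale (k * l) a.
Proof. by apply: esumP => i; exact: scalerA. Qed.

Let esum_scale1 : left_id 1 esum_scale.
Proof. by move=> a; apply: esumP => i; exact: scale1r. Qed.

Let esum_scaleDr : right_distributive esum_scale +%R.
Proof. by move=> k a b; apply: esumP => i; exact: scalerDr. Qed.

Let esum_scaleDl a : {morph esum_scale^~ a : k l / k + l >-> k + l}.
Proof. by move=> k l; apply: esumP => i; exact: scalerDl. Qed.

HB.instance Definition _ := GRing.Zmodule_isLmodule.Build R[i] esum
  esum_scaleA esum_scale1 esum_scaleDr esum_scaleDl.

Let norm a : R[i] := (esum_norm a)%:C.

Let norm_ler_normD a b : norm (a + b) <= norm a + norm b.
Proof.
rewrite -rmorphD lecR; apply: le_trans (bfs_normD HE (esumE a) (esumE b)).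
apply: (esum_le (bslD HE (esumE a) (esumE b)) _).2 => i.
by rewrite rnormDE; exact: ler_rnormD.
Qed.

Let norm_normrZ (k : R[i]) a : norm (k *: a) = `|k| * norm a.
Proof.
rewrite /norm rnormE -rmorphM; congr (_%:C).
rewrite -(rnorm_norm (k : R[i]^o)) -(bfs_normZ HE _ (esumE a)); congr N.
by apply/funext => i; rewrite !fctE; exact: normrZ.
Qed.

Lemma esum_coord a i : rnorm (a i) <= esum_norm a.
Proof. by have := bsl_coord HE i (esumE a); rewrite rnorm_norm. Qed.

Let norm_normr0_eq0 a : norm a = 0 -> a = 0.
Proof.
move=> [a0]; apply: esumP => i; apply: rnorm0_eq0; apply/eqP.
by rewrite eq_le rnorm_ge0 andbT -a0 esum_coord.
Qed.

HB.instance Definition _ := Lmodule_isNormed.Build R[i] esum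
  norm_ler_normD norm_normrZ norm_normr0_eq0.

Let dist_norm i (x y : A i) : rnorm (`|x| - `|y| : R[i]) <= rnorm (x - y).
Proof. by rewrite !rnormE -rmorphB rnormC ler_dist_rnorm. Qed.

Lemma esum_complete (F : set_system esum) : ProperFilter F -> cauchy F -> cvg F.
Proof.
apply: seq_complete => u un.
have uc e : 0 < e -> exists k, forall m n, (k <= m)%N -> (k <= n)%N ->
    rnorm (u m - u n) < e.
  move=> e0; have e20 : 0 < e / 2 by rewrite divr_gt0.
  have [k _ Hk] := un _ e20; exists k => m n km kn.
  have -> : u m - u n = (u m - u k) - (u n - u k) by rewrite opprB addrA subrK.
  by rewrite (le_lt_trans (ler_rnormB _ _))// [e]splitr ltrD//;
    apply: Hk => //=.
have ucoord i e : 0 < e -> exists k, forall m n, (k <= m)%N -> (k <= n)%N ->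
    rnorm (u m i - u n i) < e.
  move=> /uc[k Hk]; exists k => m n km kn.
  exact: le_lt_trans (esum_coord (u m - u n) i) (Hk _ _ km kn).
pose l i := lim (u n i @[n --> \oo]).
have ul i : u n i @[n --> \oo] --> l i by exact: cauchy_seq_cvg (ucoord i).
have lP : l \in esum_pred.
  apply/asboolP; apply: (bsl_limit HE (u := fun n i => `|u n i|) _ _ _).1 => //.
  - by move=> n; exact: esumE.
  - move=> e /uc[k Hk]; exists k => m n km kn.
    apply: le_lt_trans (Hk _ _ km kn).
    apply: (bsl_le HE (esumE (u m - u n)) _).2 => i.
    by rewrite rnorm_norm; exact: dist_norm.
  - move=> i; have /cvg_rnormP := ul i.
    apply: (squeeze_cvgr _ (cvg_cst 0)); near=> n.
    by rewrite rnorm_ge0 dist_norm.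
exists (ESum lP); apply/cvgrPdist_le => e e0.
have [k Hk] := uc e e0; exists k => // n /= kn.
rewrite sub0r normrN ger0_norm ?rnorm_ge0//.
pose d m : I -> R[i] := fun i => `|u n i - u m i|.
have Ed m : E (d m) by exact: esumE (u n - u m).
have [Edl dl] : E (fun i => `|u n i - l i|) /\
    N (d m - (fun i => `|u n i - l i|)) @[m --> \oo] --> (0 : R).
  apply: (bsl_limit HE) => //.
  - move=> e' /uc[k' Hk']; exists k' => m m' km km'.
    apply: le_lt_trans (Hk' _ _ km' km).
    apply: (bsl_le HE (esumE (u m' - u m)) _).2 => i.
    rewrite rnorm_norm (le_trans (dist_norm _ _))//.
    by rewrite opprB addrC subrKA.
  - move=> i; have /cvg_rnormP := ul i.
    apply: (squeeze_cvgr _ (cvg_cst 0)); near=> m.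
    rewrite rnorm_ge0 (le_trans (dist_norm _ _))// opprB addrC subrKA.
    by rewrite rnormB.
have h : N (d m - (fun i => `|u n i - l i|)) + e @[m --> \oo] --> 0 + e.
  by apply: cvgD => //; exact: cvg_cst.
rewrite add0r in h.
apply: ler_cvg_to (cvg_cst _) h _.
exists k => // m /= km.
have Em := bslB HE (Ed m) Edl; have := bfs_normD HE (bslZ HE (-1) Em) (Ed m).
rewrite scaleN1r opprB subrK => /le_trans; apply; rewrite lerD//.
  by rewrite (bsl_norm_distr HE).
by apply/ltW; exact: Hk.
Unshelve. all: by end_near. Qed.

HB.instance Definition _ := Uniform_isComplete.Build esum esum_complete.

Let esum_mulA : associative esum_mul.
Proof. by move=> a b c; apply: esumP => i; exact: bmulA. Qed.

Let esum_mul_bilinear : bilinear_map esum_mul.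
Proof.
split=> [b k a a'|a k b b']; apply: esumP => i.
  exact: (@bmul_bilinear _ (A i)).1.
exact: (@bmul_bilinear _ (A i)).2.
Qed.

Let ler_norm_esum_mul a b : `|esum_mul a b| <= `|a| * `|b|.
Proof.
rewrite !rnormE -rmorphM lecR -(ger0_norm (rnorm_ge0 a)) -rnormC.
rewrite -[rnorm b]/(esum_norm b) -(bfs_normZ HE _ (esumE b)).
apply: (esum_le (bslZ HE _ (esumE b)) _).2 => i.
rewrite !fctE rnormM rnorm_norm rnormC (ger0_norm (rnorm_ge0 a)).
rewrite (le_trans (ler_rnorm_bmul _ _))// ler_wpM2r ?rnorm_ge0//.
exact: esum_coord.
Qed.

HB.instance Definition _ := isBanachAlgebra.Build R[i] esum
  esum_mulA esum_mul_bilinear ler_norm_esum_mul.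

End ESum.

(* Main.v *)
Require Import Defs.
From mathcomp Require Import all_boot all_order all_algebra.
From mathcomp Require Import complex finmap.
From mathcomp Require Import boolp classical_sets functions cardinality reals.
From mathcomp Require Import ereal topology normedtype.
From mathcomp Require Import sequences ring lra.

Set Implicit Arguments.
Unset Strict Implicit.
Unset Printing Implicit Defensive.

Import Order.TTheory GRing.Theory Num.Theory.
Import numFieldNormedType.Exports.
Local Open Scope classical_set_scope.
Local Open Scope ring_scope.
Local Open Scope complex_scope.

(** The lower bound holds because each coordinate projection is a contractive
  quotient map. For the upper bound, a functional [f] on the projective square
  of the sum restricts to blocks [f_i] on those of the [A_i], and averaging
  [f (sum_i g_i x_i, sum_i g_i y_i)] over signs [g] gives
  [sum_(i in F) |f_i| <= |chi_F|^2 |f|]. So [D f = sum_i M_i f_i] converges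
  absolutely for bounded virtual diagonals [M_i] of the [A_i], and [D] is a
  virtual diagonal of the sum; no weak* compactness is needed. For the necessity
  of [sup_i w_i < +oo], a virtual diagonal [M] yields
  [f a = M (f o lmul a o pi)]. When [f] factors through the [i]-th coordinate
  and [a] lives in [A i], the functional on the right has norm at most
  [|f| |a| |pi| / w i]; hence [w i] is bounded, as soon as [A i] has a non-zero
  functional. *)

(** * Real-valued norms of complex numbers *)

Section ComplexNorm.
Variable R : realType.

Lemma rnorm_gt0 (V : normedZmodType R[i]) (x : V) : (0 < rnorm x) = (x != 0).
Proof. by rewrite -ltcR -rnormE normr_gt0. Qed.

Lemma rnorm1 : rnorm (1 : R[i]) = 1.
Proof. by rewrite (rnormC 1) normr1. Qed.

Lemma rnormi : rnorm ('i : R[i]) = 1.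
Proof. by rewrite /rnorm normc_def/= expr0n add0r expr1n sqrtr1. Qed.

Lemma ler_Re_rnorm (z : R[i]) : `|complex.Re z| <= rnorm z.
Proof.
case: z => a b; rewrite /rnorm normc_def /= -sqrtr_sqr ler_wsqrtr//.
by rewrite lerDl sqr_ge0.
Qed.

Lemma ler_Im_rnorm (z : R[i]) : `|complex.Im z| <= rnorm z.
Proof.
case: z => a b; rewrite /rnorm normc_def /= -sqrtr_sqr ler_wsqrtr//.
by rewrite lerDr sqr_ge0.
Qed.

End ComplexNorm.

(** * Unconditional sums *)

Section HasSum.
Variables (R : realType) (I : choiceType).
Implicit Types (V W : normedModType R[i]) (F G : {fset I}).

(** Convergence along the net of finite subsets of [I]: unconditional summation, for an index set of
    any cardinality and without an order. *)
Definition has_sum V (t : I -> V) (l : V) := forall e : R, 0 < e ->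
  exists F, forall G, (F `<=` G)%fset -> rnorm (\sum_(i <- G) t i - l) < e.

Lemma has_sum_unique V (t : I -> V) l l' :
  has_sum t l -> has_sum t l' -> l = l'.
Proof.
move=> tl tl'; apply/eqP; rewrite -subr_eq0; apply/eqP/rnorm0_eq0.
apply/eqP; rewrite eq_le rnorm_ge0 andbT; apply/ler_addgt0Pr => e e0.
have e20 : 0 < e / 2 by rewrite divr_gt0.
have [F HF] := tl _ e20; have [G HG] := tl' _ e20.
have := HF (F `|` G)%fset (fsubsetUl _ _).
have := HG (F `|` G)%fset (fsubsetUr _ _).
set s := \sum_(_ <- _) _ => sl' sl.
have -> : l - l' = (s - l') - (s - l) by rewrite opprB [RHS]addrC subrKA.
by rewrite add0r [e]splitr (le_trans (ler_rnormB _ _))// lerD// ltW.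
Qed.

Lemma has_sumZD V (k : R[i]) (t t' : I -> V) l l' :
  has_sum t l -> has_sum t' l' ->
  has_sum (fun i => k *: t i + t' i) (k *: l + l').
Proof.
move=> tl tl' e e0; have na : 0 < rnorm k + 1 by rewrite ltr_wpDl ?rnorm_ge0.
have [|F HF] := tl (e / 2 / (rnorm k + 1)); first by rewrite !divr_gt0.
have [|G HG] := tl' (e / 2); first by rewrite divr_gt0.
exists (F `|` G)%fset => H; rewrite fsubUset => /andP[/HF FH /HG GH].
rewrite big_split /= -scaler_sumr opprD addrACA -scalerBr [e]splitr.
rewrite (le_lt_trans (ler_rnormD _ _))// ler_ltD// rnormZ.
rewrite (@le_trans _ _ ((rnorm k + 1) * (e / 2 / (rnorm k + 1))))//.
  by apply: ler_pM; rewrite ?rnorm_ge0 ?lerDl// ltW.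
by rewrite mulrC divfK// gt_eqF.
Qed.

Lemma has_sum_bop V W (L : bop V W) (t : I -> V) l :
  has_sum t l -> has_sum (fun i => L (t i)) (L l).
Proof.
move=> tl e e0; have [M M0 LM] := bop_bounded L.
have M1 : 0 < M + 1 by rewrite ltr_wpDl.
have [|F HF] := tl (e / (M + 1)); first by rewrite divr_gt0.
exists F => G /HF GH; rewrite -linear_sum -linearB.
rewrite (le_lt_trans (LM _))// -(@ltr_pM2l _ (M + 1)^-1) ?invr_gt0//.
rewrite [ltRHS]mulrC (le_lt_trans _ GH)// ler_pdivrMl//.
by rewrite ler_wpM2r ?rnorm_ge0// lerDl.
Qed.

Lemma has_sum_le V (t : I -> V) l (B : R) : has_sum t l ->
  (forall F, rnorm (\sum_(i <- F) t i) <= B) -> rnorm l <= B.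
Proof.
move=> tl tB; apply/ler_addgt0Pr => e /tl[F /(_ F (fsubset_refl F)) Fe].
set s := \sum_(_ <- _) _ in Fe.
rewrite -(subKr s l) (le_trans (ler_rnormB _ _))// lerD//; first exact: tB.
exact: ltW.
Qed.

Lemma ler_sum_fset (r : I -> R) F G : (forall i, 0 <= r i) -> (F `<=` G)%fset ->
  \sum_(i <- F) r i <= \sum_(i <- G) r i.
Proof.
move=> r0 FG; rewrite [leRHS](big_fsetID _ (mem F)) /=.
have -> : [fset x in G | x \in F]%fset = F.
  apply/fsetP => x; rewrite !inE/= andbC.
  by case xF: (x \in F) => //=; exact: (fsubsetP FG).
by rewrite lerDl sumr_ge0.
Qed.

(** The finite partial sums increase with the index set, so they converge to their supremum. The
    values lie in [R[i]^o] because [has_sum] speaks of complex normed spaces. *)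
Lemma summable_ge0 (r : I -> R) (B : R) : (forall i, 0 <= r i) ->
  (forall F, \sum_(i <- F) r i <= B) ->
  exists l : R, has_sum (fun i => (r i)%:C : R[i]^o) (l%:C : R[i]^o).
Proof.
move=> r0 rB; pose S := range (fun F => \sum_(i <- F) r i).
have Ssup : has_sup S.
  by split; [exists 0, fset0; rewrite ?big_seq_fset0|exists B => _ [F _ <-]].
exists (sup S) => e e0; have [_ [F _ <-] Fe] := sup_adherent e0 Ssup.
exists F => G FG; rewrite -(rmorph_sum (@real_complex _))/= -rmorphB.
rewrite [rnorm _]rnormC ltr_norml.
have GS : \sum_(i <- G) r i <= sup S by apply: sup_upper_bound => //; exists G.
have := ler_sum_fset r0 FG; move: Fe GS.
by move: (sup S) (\sum_(i <- F) _) (\sum_(i <- G) _) => s a b; lra.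
Qed.

Lemma summable_real (r : I -> R) (B : R) :
  (forall F, \sum_(i <- F) `|r i| <= B) ->
  exists l : R, has_sum (fun i => (r i)%:C : R[i]^o) (l%:C : R[i]^o).
Proof.
move=> rB.
(* [r] is the difference of the non-negative families [|r| + r] and [|r|]. *)
have [l1 Hl1] : exists l : R,
    has_sum (fun i => (`|r i| + r i)%:C : R[i]^o) (l%:C : R[i]^o).
  apply: (@summable_ge0 _ (B + B)) => [i|F].
    by rewrite -lerBlDr sub0r -normrN ler_norm.
  rewrite big_split/= lerD// (le_trans _ (rB F))//.
  by apply: ler_sum => i _; exact: ler_norm.
have [l2 Hl2] := @summable_ge0 (fun i => `|r i|) B (fun i => normr_ge0 _) rB.
have BE (a b : R) : (a - b)%:C = -1 *: (b%:C : R[i]^o) + a%:C :> R[i]^o.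
  by rewrite scaleN1r [RHS]addrC [LHS]rmorphB.
exists (l1 - l2); rewrite BE; have := has_sumZD (-1) Hl2 Hl1.
by congr has_sum; apply/funext => i; rewrite -BE [_ + r i]addrC addrK.
Qed.

(** Absolute convergence suffices: the real and imaginary parts are dominated by the norm, and each
    is summable. *)
Lemma summable (t : I -> R[i]^o) (B : R) :
  (forall F, \sum_(i <- F) rnorm (t i) <= B) -> exists l, has_sum t l.
Proof.
move=> tB.
have [a Ha] : exists a : R,
    has_sum (fun i => (complex.Re (t i))%:C : R[i]^o) (a%:C : R[i]^o).
  apply: (@summable_real _ B) => F; apply: le_trans (tB F).
  by apply: ler_sum => i _; exact: ler_Re_rnorm.
have [b Hb] : exists b : R,
    has_sum (fun i => (complex.Im (t i))%:C : R[i]^o) (b%:C : R[i]^o).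
  apply: (@summable_real _ B) => F; apply: le_trans (tB F).
  by apply: ler_sum => i _; exact: ler_Im_rnorm.
exists ('i *: (b%:C : R[i]^o) + a%:C).
rewrite (_ : t = fun i =>
  'i *: ((complex.Im (t i))%:C : R[i]^o) + (complex.Re (t i))%:C).
  exact: has_sumZD.
by apply/funext => i; rewrite {1}[t i]complexE addrC.
Qed.

Lemma ler_rnorm_sum V (t : I -> V) (s : seq I) :
  rnorm (\sum_(i <- s) t i) <= \sum_(i <- s) rnorm (t i).
Proof.
elim: s => [|i s IH]; first by rewrite !big_nil rnorm0.
by rewrite !big_cons (le_trans (ler_rnormD _ _))// lerD.
Qed.

End HasSum.

(** * The Hahn-Banach theorem *)

Section HahnBanach.
Variables (R : realType) (V : lmodType R[i]).
Implicit Types (p q : V -> R) (x y z : V).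

(** Sublinearity over the reals, on a complex space. For [t > 0] the inequality implies equality, by
    applying it to the inverse of [t]. *)
Definition sublinear q := (forall x y, q (x + y) <= q x + q y) /\
  (forall t : R, 0 < t -> forall x, q (t%:C *: x) <= t * q x).

Lemma sublinearZ q (t : R) x : sublinear q -> 0 < t -> q (t%:C *: x) = t * q x.
Proof.
move=> [_ qZ] t0; apply/eqP; rewrite eq_le qZ// andTb.
have tC : t%:C != 0 :> R[i] by rewrite fmorph_eq0 gt_eqF.
by rewrite -ler_pdivlMl// -{1}(scalerK tC x) -fmorphV qZ// invr_gt0.
Qed.

Lemma sublinear0 q : sublinear q -> q 0 = 0.
Proof.
move=> qs; have := sublinearZ 0 qs (ltr0Sn R 1); rewrite scaler0.
by lra.
Qed.

Lemma sublinear_geN q x : sublinear q -> - q (- x) <= q x.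
Proof.
move=> qs; have := qs.1 x (- x); rewrite subrr (sublinear0 qs).
by lra.
Qed.

(* The competitors to a minimal sublinear functional: [q'] is the infimum of
   [q (x + t z) - t q z] over [t >= 0]. *)
Lemma sublinear_below q z : sublinear q -> exists q',
  [/\ sublinear q', forall x, q' x <= q x & forall x, q' x <= q (x + z) - q z].
Proof.
move=> qs; pose S x :=
  [set q (x + t%:C *: z) - t * q z | t in [set t : R | 0 <= t]].
have qtz (t : R) : 0 <= t -> q (t%:C *: z) = t * q z.
  rewrite le_eqVlt => /orP[/eqP <-|]; last exact: sublinearZ.
  by rewrite scale0r sublinear0// mul0r.
have Slb x : lbound (S x) (- q (- x)).
  move=> _ [t /= t0 <-]; rewrite -qtz// lerBrDr addrC lerBlDr.
  by have := qs.1 (x + t%:C *: z) (- x); rewrite addrAC subrr add0r.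
have Sinf x : has_inf (S x).
  split; last by exists (- q (- x)).
  by exists (q (x + 0 *: z) - 0 * q z), 0; rewrite /= ?lexx.
have leS x (t : R) : 0 <= t -> inf (S x) <= q (x + t%:C *: z) - t * q z.
  by move=> t0; apply: ge_inf; [case: (Sinf x)|exists t].
exists (fun x => inf (S x)); split.
- split=> [x y|t t0 x].
    apply/ler_addgt0Pr => e e0; have e20 : 0 < e / 2 by rewrite divr_gt0.
    have [_ [s /= s0 <-] sx] := inf_adherent e20 (Sinf x).
    have [_ [t /= t0 <-] ty] := inf_adherent e20 (Sinf y).
    apply: le_trans (leS _ _ (addr_ge0 s0 t0)) _.
    have := qs.1 (x + s%:C *: z) (y + t%:C *: z).
    rewrite addrACA -scalerDl -rmorphD mulrDl; move: sx ty.
    move: (inf _) (inf _) (q _) (q _) (q _) (s * q z) (t * q z).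
    by move=> *; lra.
  rewrite -ler_pdivrMl//; apply: lb_le_inf; first by case: (Sinf x).
  move=> _ [s /= s0 <-]; rewrite ler_pdivrMl// mulrBr.
  apply: le_trans (leS _ (t * s) _) _; first by rewrite mulr_ge0// ltW.
  by rewrite rmorphM -scalerA -scalerDr sublinearZ// mulrA.
- by move=> x; have := leS x 0 (lexx _); rewrite scale0r addr0 mul0r subr0.
- by move=> x; have := leS x 1 ler01; rewrite scale1r mul1r.
Qed.

(** Zorn's lemma for the reversed pointwise order. A chain is bounded by its pointwise infimum,
    which is finite because each member satisfies [s x >= - s (- x) >= - p (- x)]. *)
Lemma sublinear_minimal p : sublinear p -> exists q, [/\ sublinear q,
  forall x, q x <= p x &
  forall q', sublinear q' -> (forall x, q' x <= q x) -> q' = q].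
Proof.
move=> ps; pose T := {q | sublinear q /\ forall x, q x <= p x}.
pose rel_T (s t : T) := `[< forall x, sval t x <= sval s x >].
have [| | |A Atot|[q [qs qp]] qmin] := @Zorn T rel_T.
- by move=> s; apply/asboolP.
- move=> r s t /asboolP rs /asboolP st; apply/asboolP => x.
  exact: le_trans (st x) (rs x).
- move=> [s Ps] [t Pt] /asboolP/= st /asboolP/= ts.
  have stE : s = t by apply/funext => x; apply/eqP; rewrite eq_le st ts.
  by subst t; congr exist; exact: Prop_irrelevance.
- have [[s0 As0]|A0] := pselect (A !=set0); last first.
    have Pp : sublinear p /\ forall x, p x <= p x by [].
    by exists (exist _ p Pp) => s As; exfalso; apply: A0; exists s.
  pose S x := [set sval s x | s in A].
  have Sinf x : has_inf (S x).
    split; first by exists (sval s0 x), s0.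
    exists (- p (- x)) => _ [[s [ss sp]] /= _ <-].
    by rewrite (le_trans _ (sublinear_geN _ ss))// lerN2.
  have leS x s : A s -> inf (S x) <= sval s x.
    by move=> As; apply: ge_inf; [case: (Sinf x)|exists s].
  have mP : sublinear (fun x => inf (S x)) /\ forall x, inf (S x) <= p x.
    split; last by move=> x; exact: le_trans (leS _ _ As0) ((svalP s0).2 x).
    split=> [x y|t t0 x].
      apply/ler_addgt0Pr => e e0; have e20 : 0 < e / 2 by rewrite divr_gt0.
      have [_ [s /= As <-] sx] := inf_adherent e20 (Sinf x).
      have [_ [t /= At <-] ty] := inf_adherent e20 (Sinf y).
      (* Two members of a chain are comparable, so the smaller one serves at [x] and at [y] at
         once. *)
      have [u Au [us ut]] : exists2 u, A u &
          sval u x <= sval s x /\ sval u y <= sval t y.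
        by have [/asboolP st|/asboolP ts] := Atot _ _ As At; [exists t|exists s].
      rewrite (le_trans (leS _ _ Au))// (le_trans ((svalP u).1.1 _ _))//.
      by move: sx ty us ut; move: (inf _) (inf _) => *; lra.
    rewrite -ler_pdivrMl//; apply: lb_le_inf; first by case: (Sinf x).
    move=> _ [s /= As <-]; rewrite ler_pdivrMl//.
    by rewrite (le_trans (leS _ _ As))// (svalP s).1.2.
  exists (exist _ (fun x => inf (S x)) mP) => s As; apply/asboolP => x /=.
  exact: leS.
- exists q; split=> // q' q's q'q.
  have Pq' : sublinear q' /\ forall x, q' x <= p x.
    by split=> // x; exact: le_trans (q'q x) (qp x).
  have := qmin (exist _ q' Pq') => /(_ _)/(congr1 sval)/= -> //.
  exact/asboolP.
Qed.

(** A minimal sublinear functional is additive: its competitor in the direction [y] coincides with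
    it, which gives [q x <= q (x + y) - q y], the converse of subadditivity. *)
Lemma real_functional p : sublinear p -> exists q, [/\
  forall x y, q (x + y) = q x + q y,
  forall (t : R) x, q (t%:C *: x) = t * q x &
  forall x, q x <= p x].
Proof.
move=> /sublinear_minimal[q [qs qp qmin]].
have qD x y : q (x + y) = q x + q y.
  apply/eqP; rewrite eq_le qs.1 andTb -lerBrDr.
  have [q' [q's q'q q'y]] := sublinear_below y qs.
  by rewrite -{1}(qmin q' q's q'q).
have q0 := sublinear0 qs.
have qN x : q (- x) = - q x.
  by apply/eqP; rewrite -addr_eq0 -qD addNr q0.
exists q; split=> // t x; have [t0|t0|->] := ltgtP t 0.
- rewrite -[t]opprK rmorphN scaleNr qN sublinearZ ?mulNr// oppr_gt0//.
- exact: sublinearZ.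
- by rewrite scale0r q0 mul0r.
Qed.

End HahnBanach.

Lemma nonzero_functional (R : realType) (V : normedModType R[i]) (z : V) :
  z != 0 -> exists f : dual V, f z != 0.
Proof.
rewrite -rnorm_gt0 => nz.
have ps : sublinear (fun x : V => rnorm x).
  split=> [x y|t t0 x]; first exact: ler_rnormD.
  by rewrite rnormZ rnormC gtr0_norm.
(* The competitor [p] of the norm in the direction [z] satisfies [p (- z) <= - rnorm z]. Any linear
   [q] below it therefore has [q z >= rnorm z]. *)
have [p [/real_functional[q [qD qZ qp]] pn pz]] := sublinear_below z ps.
have qN x : q (- x) = - q x by have := qZ (-1) x; rewrite rmorphN1 scaleN1r mulN1r.
have qn x : `|q x| <= rnorm x.
  rewrite ler_norml lerNl -qN -(rnormN x).
  rewrite (le_trans (qp _) (pn _)) andTb rnormN.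
  exact: le_trans (qp _) (pn _).
have qz : 0 < q z.
  rewrite (lt_le_trans nz)// -lerN2 -qN (le_trans (qp _))//.
  by rewrite (le_trans (pz _))// addNr rnorm0 sub0r.
(* The usual complexification [q x - i q (i x)] of a real functional. *)
pose f (x : V) : R[i]^o := q x +i* - q ('i *: x).
have fl : linear f.
  move=> [a b] x y.
  have abE (w : V) : (a +i* b) *: w = a%:C *: w + b%:C *: ('i *: w).
    by rewrite scalerA -scalerDl; congr (_ *: _); simpc.
  have iE (w : V) : 'i *: ((a +i* b) *: w) = a%:C *: ('i *: w) + (- b)%:C *: w.
    by rewrite !scalerA -scalerDl; congr (_ *: _); simpc.
  rewrite /f scalerDr iE abE !qD !qZ.
  transitivity ((a +i* b) * (q x +i* - q ('i *: x)) + (q y +i* - q ('i *: y)));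
    last by [].
  by simpc; apply/eqP; rewrite eq_complex /=; apply/andP; split; apply/eqP; ring.
(* The factor [2] comes from adding the bounds of the two parts; only continuity of [f] matters
   here. *)
have fM x : rnorm (f x) <= 2 * rnorm x.
  rewrite /f.
  have -> : q x +i* - q ('i *: x) = (q x)%:C + 'i * (- q ('i *: x))%:C by simpc.
  rewrite (le_trans (ler_rnormD _ _))// rnormM !rnormC normrN.
  rewrite rnormi mul1r mulrDl mul1r lerD//.
  have -> : rnorm x = rnorm ('i *: x); last exact: qn.
  by rewrite rnormZ rnormi mul1r.
exists (mkbop fl fM) => /=; apply/eqP => -[fz _].
by rewrite fz ltxx in qz.
Qed.

(** * Projective tensor products and virtual diagonals *)

Section TensorFunctionals.
Variable R : realType.
Implicit Types X Y Z : normedModType R[i].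

Lemma atensor_sum X Y (u : atensor X Y) s : val u = tensor_sum s ->
  to_completion (pseminorm X Y) u = \sum_(z <- s) tens z.1 z.2.
Proof.
move=> us; rewrite -linear_sum; congr to_completion; apply/val_inj; rewrite us.
elim: s {us} => [|[x y] s IH].
  by rewrite big_nil; apply/funext => B; rewrite /tensor_sum big_nil.
by rewrite big_cons -[(x, y) :: s]/([:: (x, y)] ++ s) tensor_sum_cat IH.
Qed.

(** On the algebraic tensor product, the bound follows by summing over a representation of nearly
    minimal cost; density extends it. Unlike [ptensor_lift_bounded], this estimates an operator that
    is already given. *)
Lemma ptensor_bop_le X Y Z (L : bop (ptensor X Y) Z) (M : R) : 0 <= M ->
  (forall x y, rnorm (L (tens x y)) <= M * (rnorm x * rnorm y)) -> rnorm L <= M.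
Proof.
move=> M0 LM; apply: opnorm_le => // v.
have Lu (u : atensor X Y) :
    rnorm (L (to_completion (pseminorm X Y) u)) <= M * pnorm u.
  apply/ler_addgt0Pr => e e0; have M1 : 0 < M + 1 by rewrite ltr_wpDl.
  have [s us sl] := pnorm_adherent u (divr_gt0 e0 M1).
  rewrite (atensor_sum us) linear_sum /=.
  apply: (@le_trans _ _ (M * cost s)).
    rewrite /cost; elim: s {us sl} => [|z s IH].
      by rewrite !big_nil rnorm0 mulr0.
    by rewrite !big_cons mulrDr (le_trans (ler_rnormD _ _))// lerD.
  apply: (@le_trans _ _ (M * (pnorm u + e / (M + 1)))).
    by rewrite ler_wpM2l// ltW.
  by rewrite mulrDr lerD2l mulrCA ger_pMr// ler_pdivrMr// mul1r lerDl.
apply/ler_addgt0Pr => e e0.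
have L0 : 0 <= rnorm L by exact: rnorm_ge0.
(* Replacing [v] by [u'] costs [M] times the distance in the bound and [rnorm L] times the distance
   in the value. *)
have ML : 0 < M + rnorm L + 1 by rewrite ltr_wpDl// addr_ge0.
have [u uv] := to_completion_dense v (divr_gt0 e0 ML).
set u' := to_completion _ u in uv.
have uv' : rnorm u' <= rnorm v + rnorm (u' - v).
  by rewrite -{1}(subrK v u') addrC ler_rnormD.
rewrite -(subKr u' v) linearB (le_trans (ler_rnormB _ _))//=.
apply: le_trans (lerD (Lu u) (ler_rnorm_bop L (u' - v))) _.
have -> : pnorm u = rnorm u' by rewrite rnorm_to_completion.
apply: le_trans (lerD (ler_wpM2l M0 uv') (lexx _)) _.
rewrite subKr mulrDr -addrA lerD2l -mulrDl.
apply: le_trans (_ : (M + rnorm L + 1) * rnorm (u' - v) <= _).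
  by rewrite ler_wpM2r ?rnorm_ge0// lerDl.
by rewrite mulrC -ler_pdivlMr// ltW.
Qed.

Lemma bop_tens_ex X Y X' Y' (S : bop X X') (T : bop Y Y') :
  exists L : bop (ptensor X Y) (ptensor X' Y'),
    (forall x y, L (tens x y) = tens (S x) (T y)) /\
    rnorm L <= rnorm S * rnorm T.
Proof.
have [|||L LE LM] := @ptensor_lift_bounded R X Y (ptensor X' Y')
    (fun x y => tens (S x) (T y)) (rnorm S * rnorm T); last by exists L.
- split=> [y a x x'|x a y y'].
    by rewrite (bop_linear S); exact: (tens_bilinear X' Y').1.
  by rewrite (bop_linear T); exact: (tens_bilinear X' Y').2.
- by rewrite mulr_ge0 ?rnorm_ge0.
- move=> x y; rewrite (le_trans (rnorm_tens_le _ _))// mulrACA.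
  by apply: ler_pM; rewrite ?rnorm_ge0// ler_rnorm_bop.
Qed.

Definition bop_tens X Y X' Y' (S : bop X X') (T : bop Y Y') :
  bop (ptensor X Y) (ptensor X' Y') := projT1 (cid (bop_tens_ex S T)).

Lemma bop_tensE X Y X' Y' (S : bop X X') (T : bop Y Y') x y :
  bop_tens S T (tens x y) = tens (S x) (T y).
Proof. by rewrite /bop_tens; case: cid => L []. Qed.

Lemma rnorm_bop_tens X Y X' Y' (S : bop X X') (T : bop Y Y') :
  rnorm (bop_tens S T) <= rnorm S * rnorm T.
Proof. by rewrite /bop_tens; case: cid => L []. Qed.

Lemma rnorm_bop_comp X Y Z (g : bop Y Z) (f : bop X Y) :
  rnorm (bop_comp g f) <= rnorm g * rnorm f.
Proof.
apply: opnorm_le => [|x]; first by rewrite mulr_ge0 ?rnorm_ge0.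
rewrite (le_trans (ler_rnorm_bop g _))// -mulrA ler_wpM2l ?rnorm_ge0//.
exact: ler_rnorm_bop.
Qed.

Lemma bop_compA W X Y Z (h : bop Y Z) (g : bop X Y) (f : bop W X) :
  bop_comp h (bop_comp g f) = bop_comp (bop_comp h g) f.
Proof. exact: bopP. Qed.

End TensorFunctionals.

(** * Homomorphisms and the bimodule structure of tensor squares *)

Section AlgebraMorphisms.
Variables (R : realType) (A B : banachAlgType R[i]) (T : bop A B).
Hypothesis TM : forall x y, T (bmul x y) = bmul (T x) (T y).

Lemma bop_tens_ltens a :
  bop_comp (bop_tens T T) (ltens a) = bop_comp (ltens (T a)) (bop_tens T T).
Proof. by apply: ptensor_ext => x y /=; rewrite ltensE !bop_tensE ltensE TM. Qed.

Lemma bop_tens_rtens a :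
  bop_comp (bop_tens T T) (rtens a) = bop_comp (rtens (T a)) (bop_tens T T).
Proof. by apply: ptensor_ext => x y /=; rewrite rtensE !bop_tensE rtensE TM. Qed.

Lemma product_bop_tens :
  bop_comp (product_map B) (bop_tens T T) = bop_comp T (product_map A).
Proof.
by apply: ptensor_ext => x y /=; rewrite bop_tensE !product_mapE TM.
Qed.

Lemma bop_comp_lmul a : bop_comp T (lmul a) = bop_comp (lmul (T a)) T.
Proof. by apply: bopP => x /=; exact: TM. Qed.

Lemma bop_comp_rmul a : bop_comp T (rmul a) = bop_comp (rmul (T a)) T.
Proof. by apply: bopP => x /=; exact: TM. Qed.

End AlgebraMorphisms.

(** * Virtual diagonals and quotients *)

Section VirtualDiagonals.
Variable R : realType.
Implicit Types A B : banachAlgType R[i].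

(** The second adjoints are unfolded by evaluating at functionals [f]; later computations use only
    this form. *)
Lemma virtual_diagonalP A (M : bidual (ptensor A A)) : virtual_diagonal M <->
  (forall a f, M (bop_comp f (ltens a)) = M (bop_comp f (rtens a))) /\
  (forall a f, M (bop_comp (bop_comp f (lmul a)) (product_map A)) = f a /\
               M (bop_comp (bop_comp f (rmul a)) (product_map A)) = f a).
Proof.
split=> -[Mc Md]; split.
- by move=> a f; have := congr1 (fun m : bidual _ => m f) (Mc a).
- move=> a f; have [Ml Mr] := Md a; split.
    by have := congr1 (fun m : bidual _ => m f) Ml.
  by have := congr1 (fun m : bidual _ => m f) Mr.
- by move=> a; apply: bopP => f; exact: Mc.
- by move=> a; split; apply: bopP => f; [exact: (Md a f).1|exact: (Md a f).2].
Qed.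

Lemma AM_ge0 A : (0 <= AM A)%E.
Proof. by apply: le_ereal_inf_tmp => _ [M _ <-]; rewrite lee_fin rnorm_ge0. Qed.

Lemma virtual_diagonal_AM_le A (M : bidual (ptensor A A)) :
  virtual_diagonal M -> (AM A <= (rnorm M)%:E)%E.
Proof. by move=> HM; apply: ereal_inf_lbound; exists M. Qed.

Lemma virtual_diagonal_near A (k : R) : (AM A < k%:E)%E ->
  exists2 M : bidual (ptensor A A), virtual_diagonal M & rnorm M <= k.
Proof.
by move=> /ereal_inf_lt[_ [M HM <-]]; rewrite lte_fin => /ltW; exists M.
Qed.

(** A virtual diagonal of [A] is pushed forward along the tensor square of [T], which is
    contractive. The map [S] expresses that [T] is onto. *)
Lemma AM_quotient A B (T : bop A B) (S : B -> A) :
  (forall x y, T (bmul x y) = bmul (T x) (T y)) -> rnorm T <= 1 ->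
  (forall b, T (S b) = b) -> (AM B <= AM A)%E.
Proof.
move=> TM T1 TS; apply: le_ereal_inf_tmp => _ [M HM <-].
pose M' : bidual (ptensor B B) := adj (adj (bop_tens T T)) M.
apply: (@le_trans _ _ (rnorm M')%:E).
  apply: virtual_diagonal_AM_le.
  move/virtual_diagonalP: HM => [Mc Md]; apply/virtual_diagonalP.
  have M'E f : M' f = M (bop_comp f (bop_tens T T)) by [].
  split=> [b f|b f].
    (* With [b] written as [T (S b)], its actions on the square of [B] come from those of [S b] on
       the square of [A]. *)
    rewrite !M'E -!bop_compA -(TS b) -bop_tens_ltens// -bop_tens_rtens//.
    by rewrite !bop_compA Mc.
  rewrite !M'E -!(bop_compA _ (product_map B)) product_bop_tens// -{1 3}(TS b).
  rewrite !bop_compA -!(bop_compA _ _ T) -bop_comp_lmul// -bop_comp_rmul//.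
  by rewrite !bop_compA (Md (S b) (bop_comp f T)).1 (Md _ _).2 /= TS.
rewrite lee_fin; apply: opnorm_le => [|f]; first exact: rnorm_ge0.
apply: le_trans (ler_rnorm_bop M _) _; rewrite ler_wpM2l ?rnorm_ge0//.
rewrite (le_trans (rnorm_bop_comp _ _))// ler_piMr ?rnorm_ge0//.
by rewrite (le_trans (rnorm_bop_tens _ _))// mulr_ile1 ?rnorm_ge0.
Qed.

End VirtualDiagonals.

(** * Virtual diagonals of E-sums *)

(** Averaging over independent signs cancels the cross terms [B (x i) (y j)]. The average is taken
    one index at a time; [x0] and [y0] collect the terms whose signs are already fixed. *)
Lemma sign_averaging (R : realType) (I : eqType) (X Y : lmodType R[i])
    (B : X -> Y -> R[i]^o) (c : R) (s : seq I) (x : I -> X) (y : I -> Y) x0 y0 :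
  bilinear_map B -> uniq s ->
  (forall g : I -> bool, rnorm (B (x0 + \sum_(i <- s) (-1) ^+ g i *: x i)
                                  (y0 + \sum_(i <- s) (-1) ^+ g i *: y i)) <= c) ->
  rnorm (B x0 y0 + \sum_(i <- s) B (x i) (y i)) <= c.
Proof.
move=> [Bl Br]; elim: s x0 y0 => [|i s IH] x0 y0 /=.
  by move=> _ /(_ (fun=> false)); rewrite !big_nil !addr0.
move=> /andP[sN us] Bc.
(* Polarization: [B x0 y0 + B xi yi] is the mean of [B (x0 + xi) (y0 + yi)] and
   [B (x0 - xi) (y0 - yi)]. *)
have mean : B x0 y0 + \sum_(j <- i :: s) B (x j) (y j) =
    2%:R^-1 *: ((B (x0 + x i) (y0 + y i) + \sum_(j <- s) B (x j) (y j)) +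
                (B (x0 - x i) (y0 - y i) + \sum_(j <- s) B (x j) (y j))).
  have BD u v z : B (u + v) z = B u z + B v z.
    by have := Bl z 1 u v; rewrite !scale1r.
  have BDr u v z : B z (u + v) = B z u + B z v.
    by have := Br z 1 u v; rewrite !scale1r.
  have BN u z : B (- u) z = - B u z.
    by apply/eqP; rewrite -addr_eq0 -BD addNr; have := Bl z (-1) 0 0;
      rewrite addr0 scaler0 scaleN1r addNr => ->.
  have BNr u z : B z (- u) = - B z u.
    by apply/eqP; rewrite -addr_eq0 -BDr addNr; have := Br z (-1) 0 0;
      rewrite addr0 scaler0 scaleN1r addNr => ->.
  rewrite big_cons !BD !BDr !BN !BNr opprK.
  move: (B x0 y0) (B x0 (y i)) (B (x i) y0) (B (x i) (y i)) (\sum_(_ <- _) _).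
  move=> a b d h S; apply: (@scalerI _ _ 2%:R); first by rewrite pnatr_eq0.
  rewrite scalerA divff ?pnatr_eq0// scale1r.
  change (2%:R * (a + (h + S)) =
    a + b + (d + h) + S + (a - b + (- d + h) + S) :> R[i]).
  by ring.
have sign (b : bool) : rnorm (B (x0 + (-1) ^+ b *: x i) (y0 + (-1) ^+ b *: y i) +
    \sum_(j <- s) B (x j) (y j)) <= c.
  (* As [i] does not occur in [s], prescribing the sign [b] at [i] leaves the sums over [s]
     unchanged. *)
  apply: IH => // g; have := Bc (fun j => if j == i then b else g j).
  rewrite !big_cons eqxx !addrA.
  have E (Z : lmodType R[i]) (z : I -> Z) :
      \sum_(j <- s) (-1) ^+ (if j == i then b else g j) *: z j =
      \sum_(j <- s) (-1) ^+ g j *: z j.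
    by apply: eq_big_seq => j js; case: eqP => // ji; rewrite -ji js in sN.
  by rewrite !E.
have := sign false; rewrite expr0 !scale1r => s0.
have := sign true; rewrite expr1 !scaleN1r => s1.
rewrite mean rnormZ -(rmorph_nat (@real_complex _)) -fmorphV.
rewrite [rnorm _%:C]rnormC gtr0_norm ?invr_gt0// ler_pdivrMl//.
by rewrite (le_trans (ler_rnormD _ _))// mulr_natl mulr2n lerD.
Qed.

(** Otherwise [f] would be bounded by [rnorm f - e] on elementary tensors, hence everywhere. A
    rotation of the first factor makes the value real, so that the values of several functionals can
    be added without cancellation. *)
Lemma functional_near_norm (R : realType) (X Y : normedModType R[i])
    (f : dual (ptensor X Y)) (e : R) : 0 < e ->
  exists z : X * Y, [/\ rnorm z.1 <= 1, rnorm z.2 <= 1 &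
    exists2 r : R, f (tens z.1 z.2) = r%:C & rnorm f - e <= r].
Proof.
move=> e0; apply: contrapT => nz.
have tens0 (x : X) (y : Y) : x = 0 \/ y = 0 -> tens x y = 0.
  move=> xy; apply: rnorm0_eq0; apply/eqP; rewrite eq_le rnorm_ge0 andbT.
  rewrite (le_trans (rnorm_tens_le _ _))//.
  by case: xy => ->; rewrite rnorm0 ?mul0r ?mulr0.
(* If [rnorm f < e], the zero tensor is already a witness. *)
have fe : 0 <= rnorm f - e.
  rewrite leNgt; apply/negP => fe; apply: nz; exists (0, 0).
  rewrite /= !rnorm0 tens0; last by left.
  by split=> //; exists 0; rewrite ?ltW// linear0.
suff : rnorm f <= rnorm f - e by move: (rnorm f) => r; lra.
apply: ptensor_bop_le => // x y.
have [->|c0] := eqVneq (f (tens x y)) 0.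
  by rewrite rnorm0 !mulr_ge0 ?rnorm_ge0.
have x0 : 0 < rnorm x.
  rewrite rnorm_gt0; apply: contra_neq c0 => x0.
  by rewrite tens0 ?linear0//; left.
have y0 : 0 < rnorm y.
  rewrite rnorm_gt0; apply: contra_neq c0 => y0.
  by rewrite tens0 ?linear0//; right.
set c := f (tens x y) in c0 *.
have nc : 0 < rnorm c by rewrite rnorm_gt0.
(* The unimodular factor for which [u * c] is the norm of [c]. *)
pose u : R[i] := (rnorm c)%:C / c.
have u1 : rnorm u = 1.
  rewrite /u rnormM rnormC ger0_norm ?rnorm_ge0//.
  apply: (mulIf (lt0r_neq0 nc)).
  by rewrite mul1r -mulrA -rnormM mulVf// rnorm1 mulr1.
rewrite leNgt; apply/negP => lt; apply: nz.
exists ((u * (rnorm x)^-1%:C) *: x, (rnorm y)^-1%:C *: y) => /=.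
have n1 (Z : normedModType R[i]) (z : Z) : 0 < rnorm z ->
    rnorm ((rnorm z)^-1%:C *: z) = 1.
  by move=> z0; rewrite rnormZ rnormC gtr0_norm ?invr_gt0// mulVf// gt_eqF.
split; first by rewrite -scalerA rnormZ u1 mul1r n1.
  by rewrite n1.
have tZ a b : tens (a *: x) (b *: y) = (a * b) *: tens x y.
  have [tl tr] := tens_bilinear X Y.
  have := tl (b *: y) a x 0; rewrite /= !addr0 [tens 0 _]tens0 ?addr0; last by left.
  move=> ->; have := tr x b y 0.
  rewrite /= !addr0 [tens _ 0]tens0 ?addr0; last by right.
  by move=> ->; rewrite scalerA.
exists (rnorm c / (rnorm x * rnorm y)); last by rewrite ler_pdivlMr ?mulr_gt0// ltW.
rewrite tZ linearZ /= -/c.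
change (u * (rnorm x)^-1%:C * (rnorm y)^-1%:C * c =
  (rnorm c / (rnorm x * rnorm y))%:C).
rewrite /u invfM !rmorphM /=.
by rewrite -[RHS]mul1r -(mulfV c0); ring.
Qed.

Lemma c00_chi (R : realType) (I : choiceType) (F : {fset I}) : c00 (chi R F).
Proof.
apply: (@finite_subfset _ F) => i /=.
by rewrite /chi; case: (i \in F); rewrite ?eqxx.
Qed.

(** * Embeddings, projections and finite sums in an E-sum *)

Section ESumDiagonal.
Variables (R : realType) (I : choiceType).
Variables (E : set (I -> R[i])) (N : (I -> R[i]) -> R).
Variable HE : banach_sequence_lattice E N.
Variable A : I -> banachAlgType R[i].
Local Notation S := (esum HE A).
Implicit Types (F G : {fset I}) (a : S).

Lemma bsl_chi F : E (chi R F).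
Proof. exact/(bsl_c00 HE)/c00_chi. Qed.

Lemma chi_in F i : i \in F -> chi R F i = 1.
Proof. by rewrite /chi => ->. Qed.

Lemma bsl_chi_ge1 F i : i \in F -> 1 <= N (chi R F).
Proof.
by move=> iF; have := bsl_coord HE i (bsl_chi F); rewrite chi_in// rnorm1.
Qed.

Lemma bsl_chi_ge0 F : 0 <= N (chi R F).
Proof. exact: (bsl_norm_ge0 HE (bsl_chi F)). Qed.

Lemma dfwith_esum_le i (x : A i) (f := eqtype.dfwith (fun j => 0 : A j) x) :
  f \in esum_pred E A /\
  N (fun j => `|f j|) <= N ((rnorm x)%:C *: chi R [fset i]%fset).
Proof.
apply: (esum_le HE (bslZ HE (rnorm x)%:C (bsl_chi [fset i]%fset))) => j.
rewrite !fctE rnormM rnormC ger0_norm ?rnorm_ge0// /f.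
case: eqtype.dfwithP => [|k ik]; last by rewrite rnorm0 mulr_ge0 ?rnorm_ge0.
by rewrite chi_in ?inE// rnorm1 mulr1.
Qed.

Definition esum_single i (x : A i) : S :=
  @Defs.ESum R I E N HE A _ (dfwith_esum_le x).1.

Lemma esum_single_linear i : linear (@esum_single i).
Proof.
move=> k x y; apply: esumP => j.
change (eqtype.dfwith (fun j => 0 : A j) (k *: x + y) j =
  k *: eqtype.dfwith (fun j => 0 : A j) x j + eqtype.dfwith (fun j => 0 : A j) y j).
have [->|ij] := eqVneq j i; first by rewrite !eqtype.dfwith_in.
by rewrite !eqtype.dfwith_out 1?eq_sym// scaler0 addr0.
Qed.

Lemma rnorm_esum_single i (x : A i) :
  rnorm (esum_single x) <= N (chi R [fset i]%fset) * rnorm x.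
Proof.
have := (dfwith_esum_le x).2.
by rewrite (bfs_normZ HE _ (bsl_chi _)) rnormC ger0_norm ?rnorm_ge0// mulrC.
Qed.

(** The bound for this embedding, [N (chi R [fset i])], may exceed one, whereas [esum_proj] is
    contractive. *)
Definition esum_inj i : bop (A i) S :=
  mkbop (@esum_single_linear i) (@rnorm_esum_single i).

Lemma esum_inj_in i (x : A i) : (esum_inj i x : S) i = x.
Proof. exact: eqtype.dfwith_in. Qed.

Lemma esum_inj_out i (x : A i) j : j != i -> (esum_inj i x : S) j = 0.
Proof. by move=> ij; apply: eqtype.dfwith_out; rewrite eq_sym. Qed.

Lemma bmul0r (B : banachAlgType R[i]) (x : B) : bmul x 0 = 0.
Proof. exact: (linear0 (lmul x)). Qed.

Lemma bmul0l (B : banachAlgType R[i]) (x : B) : bmul 0 x = 0.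
Proof. exact: (linear0 (rmul x)). Qed.

Lemma esum_injM i (x y : A i) :
  esum_inj i (bmul x y) = bmul (esum_inj i x) (esum_inj i y).
Proof.
apply: esumP => j.
change ((esum_inj i (bmul x y) : S) j =
  bmul ((esum_inj i x : S) j) ((esum_inj i y : S) j)).
have [->|ij] := eqVneq j i; first by rewrite !esum_inj_in.
by rewrite !esum_inj_out// bmul0r.
Qed.

Lemma esum_proj_linear i : linear (fun a => a i).
Proof. by []. Qed.

Lemma rnorm_esum_proj i a : rnorm (a i) <= 1 * rnorm a.
Proof. by rewrite mul1r; exact: esum_coord. Qed.

Definition esum_proj i : bop S (A i) :=
  mkbop (@esum_proj_linear i) (@rnorm_esum_proj i).

Lemma esum_sum_coord F (x : forall i, A i) j :
  (\sum_(i <- F) esum_inj i (x i) : S) j = if j \in F then x j else 0.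
Proof.
rewrite -[LHS]/(esum_proj j _) linear_sum.
change (\sum_(i <- F) (esum_inj i (x i) : S) j = if j \in F then x j else 0).
have out G : j \notin G -> \sum_(i <- G) (esum_inj i (x i) : S) j = 0.
  move=> jG; apply: big1_seq => i /= iG; apply: esum_inj_out.
  by apply: contraNneq jG => ->.
case: ifPn => [jF|]; last exact: out.
rewrite (big_fsetD1 j jF) out ?inE ?eqxx//.
exact: etrans (addr0 _) (esum_inj_in _).
Qed.

(** The coordinate norms are dominated by [chi R F], so solidity applies. This is how the norms of
    characteristic functions enter the upper bound. *)
Lemma rnorm_esum_sum F (x : forall i, A i) : (forall i, rnorm (x i) <= 1) ->
  rnorm (\sum_(i <- F) esum_inj i (x i) : S) <= N (chi R F).
Proof.
move=> x1; apply: (esum_le HE (bsl_chi F) _).2 => i.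
rewrite esum_sum_coord; case: ifPn => [iF|_]; first by rewrite chi_in// rnorm1.
by rewrite rnorm0 rnorm_ge0.
Qed.

(** Density of [c00] in [E]: off the support of an approximant [y], the remainder of [a] is
    dominated by the difference of its norm family and [y]. Hence a functional on the sum is
    determined by its values on the coordinates. *)
Lemma has_sum_esum a : has_sum (fun i => esum_inj i (a i)) a.
Proof.
move=> e e0; have [y y0 ye] := bsl_dense HE (esumE a) e0.
exists (fset_set [set i | y i != 0]) => G FG.
apply: le_lt_trans ye.
apply: (esum_le HE (bslB HE (esumE a) (bsl_c00 HE y0)) _).2 => i.
change (rnorm ((\sum_(i <- G) esum_inj i (a i) : S) i - a i) <=
  rnorm (`|a i| - y i)).
rewrite esum_sum_coord; case: ifPn => iG.
  by rewrite subrr rnorm0 rnorm_ge0.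
have -> : y i = 0.
  apply/eqP; apply: contraNT iG => yi; apply: (fsubsetP FG).
  by rewrite in_fset_set// inE.
by rewrite sub0r rnormN subr0 rnorm_norm.
Qed.

(** * Diagonal blocks of a functional on the projective square *)

Section Blocks.
Variable f : dual (ptensor S S).

Definition block i : dual (ptensor (A i) (A i)) :=
  bop_comp f (bop_tens (esum_inj i) (esum_inj i)).

(** Nearly norming tensors of the blocks are placed on the diagonal. Every signed sum of their
    factors has norm at most [N (chi R F)], and [sign_averaging] bounds the diagonal sum. *)
Lemma block_sum_le F :
  \sum_(i <- F) rnorm (block i) <= N (chi R F) ^+ 2 * rnorm f.
Proof.
have step (e : R) : 0 < e ->
    \sum_(i <- F) (rnorm (block i) - e) <= N (chi R F) ^+ 2 * rnorm f.
  move=> e0; have ch i := cid (functional_near_norm (block i) e0).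
  pose x i := (projT1 (ch i)).1; pose y i := (projT1 (ch i)).2.
  have xyP i : [/\ rnorm (x i) <= 1, rnorm (y i) <= 1 &
      exists2 r : R, block i (tens (x i) (y i)) = r%:C & rnorm (block i) - e <= r].
    exact: (projT2 (ch i)).
  pose B (u v : S) : R[i]^o := f (tens u v).
  have Bb : bilinear_map B.
    split=> [v k u u'|u k v v'].
      exact: etrans (congr1 f ((tens_bilinear S S).1 v k u u')) (bop_linear f _ _ _).
    exact: etrans (congr1 f ((tens_bilinear S S).2 u k v v')) (bop_linear f _ _ _).
  have sgn1 (g : bool) : rnorm ((-1) ^+ g : R[i]) = 1.
    by case: g; rewrite ?expr1 ?expr0 ?rnormN rnorm1.
  have bound (z : forall i, A i) (g : I -> bool) : (forall i, rnorm (z i) <= 1) ->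
      rnorm (0 + \sum_(i <- F) (-1) ^+ g i *: esum_inj i (z i) : S) <= N (chi R F).
    move=> z1; rewrite add0r.
    have -> : \sum_(i <- F) (-1) ^+ g i *: esum_inj i (z i) =
        \sum_(i <- F) esum_inj i ((-1) ^+ g i *: z i) :> S.
      by apply: eq_bigr => i _; rewrite linearZ.
    apply: (@rnorm_esum_sum F (fun i => (-1) ^+ g i *: z i)) => i.
    by rewrite rnormZ sgn1 mul1r; exact: z1.
  have B00 : B 0 0 = 0.
    by have := Bb.2 0 (-1) 0 0; rewrite scaler0 addr0 scaleN1r addNr.
  have := @sign_averaging R I S S B (N (chi R F) ^+ 2 * rnorm f) F
    (fun i => esum_inj i (x i)) (fun i => esum_inj i (y i)) 0 0 Bb (fset_uniq F).
  rewrite B00 add0r => sgn; apply: le_trans (sgn _) => [|g]; last first.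
    rewrite (le_trans (ler_rnorm_bop f _))// mulrC ler_wpM2r ?rnorm_ge0//.
    rewrite (le_trans (rnorm_tens_le _ _))// expr2.
    by apply: ler_pM; rewrite ?rnorm_ge0//; apply: bound => i; case: (xyP i).
  (* The block values are real, so the real part of the diagonal sum adds them up. *)
  apply: le_trans (ler_Re_rnorm _); apply: le_trans (ler_norm _).
  rewrite raddf_sum; apply: ler_sum => i _.
  have [_ _ [r rE]] := xyP i; move: rE => /=.
  by rewrite bop_tensE /B => ->.
(* Each index loses at most [e / (size F).+1], hence at most [e] in total; the successor avoids a
   division by zero. *)
apply/ler_addgt0Pr => e e0; have F0 : 0 < (size F).+1%:R :> R by rewrite ltr0Sn.
have := step _ (divr_gt0 e0 F0); rewrite sumrB lerBlDr => /le_trans; apply.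
rewrite lerD2l big_const_seq count_predT iter_addr_0 -[leLHS]mulr_natr -mulrA.
by rewrite ger_pMr// ler_pdivrMl// mulr1 ler_nat.
Qed.

End Blocks.

Lemma block_linear i (k : R[i]) (f g : dual (ptensor S S)) :
  block (k *: f + g) i = k *: block f i + block g i.
Proof. exact: bopP. Qed.

(** The embedding turns multiplication by [a i] into multiplication by [a]. With the analogues below
    for the right action and the product, this reduces the identities for the sum to those for each
    [A i]. *)
Lemma block_ltens a i (f : dual (ptensor S S)) :
  block (bop_comp f (ltens a)) i = bop_comp (block f i) (ltens (a i)).
Proof.
rewrite /block -!bop_compA; congr bop_comp; apply: ptensor_ext => x y /=.
rewrite ltensE !bop_tensE ltensE; congr tens; apply: esumP => j.
change (bmul (a j) ((esum_inj i x : S) j) = (esum_inj i (bmul (a i) x) : S) j).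
have [->|ij] := eqVneq j i; first by rewrite !esum_inj_in.
by rewrite !esum_inj_out// bmul0r.
Qed.

Lemma block_rtens a i (f : dual (ptensor S S)) :
  block (bop_comp f (rtens a)) i = bop_comp (block f i) (rtens (a i)).
Proof.
rewrite /block -!bop_compA; congr bop_comp; apply: ptensor_ext => x y /=.
rewrite rtensE !bop_tensE rtensE; congr tens; apply: esumP => j.
change (bmul ((esum_inj i y : S) j) (a j) = (esum_inj i (bmul y (a i)) : S) j).
have [->|ij] := eqVneq j i; first by rewrite !esum_inj_in.
by rewrite !esum_inj_out// bmul0l.
Qed.

Lemma block_product i (g : dual S) :
  block (bop_comp g (product_map S)) i =
  bop_comp (bop_comp g (esum_inj i)) (product_map (A i)).
Proof.
rewrite /block -!bop_compA; congr bop_comp; apply: product_bop_tens.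
exact: esum_injM.
Qed.

Lemma lmul_esum_inj a i :
  bop_comp (lmul a) (esum_inj i) = bop_comp (esum_inj i) (lmul (a i)).
Proof.
apply: bopP => x; apply: esumP => j.
change (bmul (a j) ((esum_inj i x : S) j) = (esum_inj i (bmul (a i) x) : S) j).
have [->|ij] := eqVneq j i; first by rewrite !esum_inj_in.
by rewrite !esum_inj_out// bmul0r.
Qed.

Lemma rmul_esum_inj a i :
  bop_comp (rmul a) (esum_inj i) = bop_comp (esum_inj i) (rmul (a i)).
Proof.
apply: bopP => x; apply: esumP => j.
change (bmul ((esum_inj i x : S) j) (a j) = (esum_inj i (bmul x (a i)) : S) j).
have [->|ij] := eqVneq j i; first by rewrite !esum_inj_in.
by rewrite !esum_inj_out// bmul0l.
Qed.

(** The series defining the diagonal converges absolutely by [block_sum_le]; its linearity and the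
    commutation identity hold termwise. For the product, the terms are the values of [f] on the
    coordinates of [a], and these sum to [f a]. *)
Lemma esum_virtual_diagonal (M : forall i, bidual (ptensor (A i) (A i))) (C K : R) :
  (forall F, N (chi R F) <= C) -> 0 <= K ->
  (forall i, virtual_diagonal (M i)) -> (forall i, rnorm (M i) <= K) ->
  exists2 D : bidual (ptensor S S), virtual_diagonal D & rnorm D <= C ^+ 2 * K.
Proof.
move=> NC K0 HM MK.
have C0 : 0 <= C by exact: le_trans (bsl_chi_ge0 fset0) (NC _).
pose t (f : dual (ptensor S S)) i : R[i]^o := M i (block f i).
have tle f F : \sum_(i <- F) rnorm (t f i) <= C ^+ 2 * K * rnorm f.
  apply: (@le_trans _ _ (\sum_(i <- F) K * rnorm (block f i))).
    apply: ler_sum => i _; apply: le_trans (ler_rnorm_bop (M i) _) _.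
    by rewrite ler_wpM2r ?rnorm_ge0//; exact: MK.
  rewrite -mulr_sumr [_ * K]mulrC -mulrA ler_wpM2l//.
  rewrite (le_trans (block_sum_le f F))// ler_wpM2r ?rnorm_ge0//.
  by rewrite lerXn2r ?nnegrE ?bsl_chi_ge0.
have [d dP] := choice (fun f => summable (tle f)).
have dl : linear (d : dual (ptensor S S) -> R[i]^o).
  move=> k f g; apply: has_sum_unique (dP _) _.
  have -> : t (k *: f + g) = fun i => k *: t f i + t g i.
    by apply/funext => i; rewrite /t block_linear (bop_linear (M i)).
  exact: has_sumZD.
have dM f : rnorm (d f) <= C ^+ 2 * K * rnorm f.
  apply: has_sum_le (dP f) _ => F.
  by rewrite (le_trans (ler_rnorm_sum _ _)).
exists (mkbop dl dM); last first.
  by apply: opnorm_le => //; rewrite mulr_ge0// sqr_ge0.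
have dE f x : has_sum (t f) x -> d f = x by exact: has_sum_unique.
have MP i := (virtual_diagonalP (M i)).1 (HM i).
apply/virtual_diagonalP; split=> [a f|a f]; last split.
- change (d (bop_comp f (ltens a)) = d (bop_comp f (rtens a))).
  apply: dE; rewrite (_ : t _ = t (bop_comp f (rtens a))); first exact: dP.
  by apply/funext => i; rewrite /t block_ltens block_rtens (MP i).1.
- apply: dE; rewrite (_ : t _ = fun i => f (esum_inj i (a i))).
    exact: has_sum_bop (has_sum_esum a).
  apply/funext => i; rewrite /t block_product -(bop_compA f) lmul_esum_inj bop_compA.
  by rewrite ((MP i).2 _ _).1.
- apply: dE; rewrite (_ : t _ = fun i => f (esum_inj i (a i))).
    exact: has_sum_bop (has_sum_esum a).
  apply/funext => i; rewrite /t block_product -(bop_compA f) rmul_esum_inj bop_compA.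
  by rewrite ((MP i).2 _ _).2.
Qed.

Lemma AM_le_esum i : (AM (A i) <= AM S)%E.
Proof.
apply: (@AM_quotient R S (A i) (esum_proj i) (esum_inj i)) => //.
  by apply: opnorm_le => // x; exact: rnorm_esum_proj.
by move=> x; exact: esum_inj_in.
Qed.

End ESumDiagonal.

(** Supplies the coordinatewise limits in [c0w_complete], through real and imaginary parts. *)
Lemma complex_cauchy_cvg (R : realType) (z : nat -> R[i]) :
  (forall e : R, 0 < e -> exists k, forall m n, (k <= m)%N -> (k <= n)%N ->
     rnorm (z m - z n) < e) ->
  exists l, forall e : R, 0 < e -> exists k, forall n, (k <= n)%N ->
    rnorm (z n - l) < e.
Proof.
move=> zc.
have Rec : cvg ((fun n => complex.Re (z n)) @ \oo).
  apply: real_cauchy_cvg => e /zc[k Hk]; exists k => m n km kn.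
  by rewrite -raddfB (le_lt_trans (ler_Re_rnorm _))// Hk.
have Imc : cvg ((fun n => complex.Im (z n)) @ \oo).
  apply: real_cauchy_cvg => e /zc[k Hk]; exists k => m n km kn.
  by rewrite -raddfB (le_lt_trans (ler_Im_rnorm _))// Hk.
have /cvgrPdist_lt rl := Rec; have /cvgrPdist_lt il := Imc.
set a := lim _ in rl; set b := lim _ in il.
exists (a +i* b) => e e0; have e20 : 0 < e / 2 by rewrite divr_gt0.
have [k1 _ H1] := rl _ e20; have [k2 _ H2] := il _ e20.
exists (maxn k1 k2) => n; rewrite geq_max => /andP[/H1/= h1 /H2/= h2].
have -> : z n - (a +i* b) =
    (complex.Re (z n) - a)%:C + 'i * (complex.Im (z n) - b)%:C.
  by case: (z n) => c d; simpc.
rewrite (le_lt_trans (ler_rnormD _ _))// [e]splitr ltrD//.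
  by rewrite rnormC distrC.
by rewrite rnormM rnormC rnormi mul1r distrC.
Qed.

(** * Weighted c_0 *)

Section WeightedC0.
Variables (R : realType) (I : choiceType) (w : I -> R).
Hypotheses (I_neq0 : [set: I] !=set0) (w_gt0 : forall i, 0 < w i).
Local Notation E := (c0w w : set (I -> R[i])).
Local Notation N := (c0w_norm w : (I -> R[i]) -> R).
Implicit Types (x y : I -> R[i]) (F : {fset I}).

Lemma c0w_ub x : E x -> has_ubound (range (fun i => w i * rnorm (x i))).
Proof.
move=> /(_ 1 ltr01) fin.
have v0 i : 0 <= w i * rnorm (x i) by rewrite mulr_ge0 ?rnorm_ge0// ltW.
(* Only finitely many terms reach [1]; their sum bounds each of them, and [1] bounds the others. *)
exists (1 + \sum_(i <- fset_set [set i | 1 <= w i * rnorm (x i)]) w i * rnorm (x i)).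
move=> _ [i _ <-]; have [i1|i1] := leP 1 (w i * rnorm (x i)); last first.
  by rewrite (le_trans (ltW i1))// lerDl sumr_ge0.
rewrite (big_fsetD1 i) ?in_fset_set ?inE//= addrCA lerDl.
by rewrite addr_ge0// sumr_ge0.
Qed.

Lemma c0w_norm_ge x i : E x -> w i * rnorm (x i) <= N x.
Proof.
move=> /c0w_ub xb; apply: sup_upper_bound; last by exists i.
by split=> //; exists (w i * rnorm (x i)), i.
Qed.

Lemma c0w_norm_le x (M : R) : (forall i, w i * rnorm (x i) <= M) -> N x <= M.
Proof.
move=> xM; apply: ge_sup; last by move=> _ [i _ <-].
by case: I_neq0 => i _; exists (w i * rnorm (x i)), i.
Qed.

Lemma c0w_norm_ge0 x : E x -> 0 <= N x.
Proof.
case: I_neq0 => i _ /(c0w_norm_ge i); apply: le_trans.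
by rewrite mulr_ge0 ?rnorm_ge0// ltW.
Qed.

Lemma c0w_c00 : c00 (R := R) (I := I) `<=` E.
Proof.
move=> x x0 e e0; apply: sub_finite_set x0 => i /= ei; apply/eqP => xi.
by rewrite xi rnorm0 mulr0 leNgt e0 in ei.
Qed.

Lemma weight_chi F i : w i * rnorm (chi R F i) = if i \in F then w i else 0.
Proof.
by rewrite /chi; case: ifP => _; rewrite ?rnorm0 ?rnorm1 ?mulr1 ?mulr0.
Qed.

(** The default [0] of the maximum accounts for the indices outside [F] and for an empty [F]. *)
Lemma c0w_norm_chi F : N (chi R F) = \big[Num.max/0]_(i <- F) w i.
Proof.
have EF := c0w_c00 (c00_chi R F).
apply/eqP; rewrite eq_le; apply/andP; split.
  apply: c0w_norm_le => i; rewrite weight_chi; case: ifP => iF.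
    exact: unstable.le_bigmax_seq.
  exact: bigmax_ge_id.
rewrite big_seq; apply: bigmax_le; first exact: c0w_norm_ge0.
by move=> i iF; have := c0w_norm_ge i EF; rewrite weight_chi iF.
Qed.

Lemma c0w_norm_chi1 i : N (chi R [fset i]%fset) = w i.
Proof.
apply/eqP; rewrite eq_le; apply/andP; split.
  apply: c0w_norm_le => j; rewrite weight_chi inE.
  by case: eqP => [->|_] //; exact: ltW.
have := c0w_norm_ge i (c0w_c00 (c00_chi R [fset i]%fset)).
by rewrite weight_chi inE eqxx.
Qed.

Lemma lattice_const_c0w :
  lattice_const N = ereal_sup (range (fun i => (w i)%:E)).
Proof.
case: I_neq0 => i0 _; apply/eqP; rewrite eq_le; apply/andP; split; last first.
  apply: ge_ereal_sup => _ [i _ <-]; apply: ereal_sup_ubound.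
  by exists [fset i]%fset => //; rewrite c0w_norm_chi1.
have le_sup i : ((w i)%:E <= ereal_sup (range (fun i => (w i)%:E)))%E.
  by apply: ereal_sup_ubound; exists i.
apply: ge_ereal_sup => _ [F _ <-].
move: le_sup; case: (ereal_sup _) => [r| |] le_sup.
- rewrite lee_fin; apply: c0w_norm_le => i; rewrite weight_chi.
  (* The index [i0] shows that [r] is positive, which settles the indices outside [F]. *)
  have := le_sup i; have := le_sup i0; rewrite !lee_fin => w0 wi.
  by case: ifP => // _; rewrite (le_trans _ w0)// ltW.
- by rewrite leey.
- by have := le_sup i0; rewrite leeNy_eq.
Qed.

Lemma weight_has_inf : has_inf (range w).
Proof.
case: I_neq0 => i0 _; split; first by exists (w i0), i0.
by exists 0 => _ [i _ <-]; exact: ltW.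
Qed.

Lemma weight_inf_le i : inf (range w) <= w i.
Proof. by apply: ge_inf; [case: weight_has_inf|exists i]. Qed.

Lemma c0w_linfty : 0 < inf (range w) -> E `<=` linfty (R := R) (I := I).
Proof.
move=> w0 x /c0w_ub[M xM]; exists (M / inf (range w)) => _ [i _ <-].
rewrite ler_pdivlMr// mulrC; apply: le_trans (xM _ (ex_intro2 _ _ i Logic.I erefl)).
by rewrite ler_wpM2r ?rnorm_ge0// weight_inf_le.
Qed.

(* If the weights are not bounded below, choose [s n] with [w (s n) < 1 / (n+1)]:
   the function equal to [1 / sqrt w] on the range of [s], and to [0] elsewhere,
   is unbounded but lies in [c_0(I, w)]. *)
Lemma linfty_weight_inf : E `<=` linfty (R := R) (I := I) -> 0 < inf (range w).
Proof.
move=> El; rewrite ltNge; apply/negP => w0.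
have small n : exists i, w i < n.+1%:R^-1.
  have n0 : 0 < n.+1%:R^-1 :> R by rewrite invr_gt0 ltr0Sn.
  have [_ [i _ <-] wi] := inf_adherent n0 weight_has_inf.
  by exists i; rewrite (lt_le_trans wi)// gerDr.
have [s ws] := choice small.
pose x i : R[i] := if `[< range s i >] then ((Num.sqrt (w i))^-1)%:C else 0.
have sqw i : 0 < Num.sqrt (w i) by rewrite sqrtr_gt0.
have xs n : rnorm (x (s n)) = (Num.sqrt (w (s n)))^-1.
  rewrite /x asboolT; last by exists n.
  by rewrite rnormC gtr0_norm ?invr_gt0.
have Ex : E x.
  move=> e e0.
  (* At [s n] the weighted value is the square root of [w (s n)]. If it reaches [e], then
     [e ^+ 2 <= w (s n) < n.+1%:R^-1], which forces [n < k]. *)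
  have [k _ Hk] := near_infty_natSinv_lt (PosNum (exprn_gt0 2 e0)).
  apply: sub_finite_set (finite_image s (finite_II k)) => i /=.
  rewrite /x; case: asboolP => [[n _ <-]|_]; last by rewrite rnorm0 mulr0 leNgt e0.
  rewrite rnormC gtr0_norm ?invr_gt0// -{1}(sqr_sqrtr (ltW (w_gt0 (s n)))).
  rewrite expr2 mulfK ?gt_eqF// => es; exists n => //=.
  rewrite ltnNge; apply/negP => /Hk/= ke; have := lt_trans (ws n) ke.
  rewrite ltNge => /negP; apply; rewrite -(sqr_sqrtr (ltW (w_gt0 (s n)))).
  by rewrite ler_sqr ?nnegrE// ltW.
have [M xM] := El x Ex.
(* A bound [M] for [x] would keep every [w (s n)] above [M^-1 ^+ 2], although they tend to zero. *)
have sM n : (Num.sqrt (w (s n)))^-1 <= M by rewrite -xs; apply: xM; exists (s n).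
have M0 : 0 < M by apply: lt_le_trans (sM 0); rewrite invr_gt0.
have M20 : 0 < M^-1 ^+ 2 by rewrite exprn_gt0// invr_gt0.
have [k _ /(_ k (leqnn k))/= kM] := near_infty_natSinv_lt (PosNum M20).
have := lt_trans (ws k) kM; rewrite ltNge => /negP; apply.
rewrite -(sqr_sqrtr (ltW (w_gt0 (s k)))).
rewrite ler_sqr ?nnegrE ?invr_ge0 ?(ltW M0) ?(ltW (sqw _))//.
by rewrite -[Num.sqrt _]invrK lef_pV2 ?posrE ?invr_gt0.
Qed.

Lemma c0w_norm_eq x : E x -> N x = 0 -> x = 0.
Proof.
move=> Ex Nx; apply/funext => i; apply: rnorm0_eq0; apply/eqP.
rewrite eq_le rnorm_ge0 andbT -(pmulr_rle0 _ (w_gt0 i)) -Nx.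
exact: c0w_norm_ge.
Qed.

Lemma c0w0 : E 0.
Proof.
by apply: c0w_c00; apply: sub_finite_set (finite_set0 I) => i /=; rewrite eqxx.
Qed.

Lemma c0wZD (a : R[i]) x y : E x -> E y -> E (a *: x + y).
Proof.
move=> Ex Ey e e0; have e20 : 0 < e / 2 by rewrite divr_gt0.
have na : 0 < rnorm a + 1 by rewrite ltr_wpDl ?rnorm_ge0.
have finx := Ex _ (divr_gt0 e20 na); have finy := Ey _ e20.
(* If the weighted combination reaches [e], one of its two summands reaches [e / 2]. *)
apply: (@sub_finite_set _ _
    ([set i | e / 2 / (rnorm a + 1) <= w i * rnorm (x i)] `|`
    [set i | e / 2 <= w i * rnorm (y i)])); last by rewrite finite_setU.
move=> i /= ei; rewrite !leNgt; apply/orP; rewrite -negb_and.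
apply/negP => /andP[xi yi]; move: ei; rewrite leNgt => /negP; apply.
change (w i * rnorm (a * x i + y i) < e).
rewrite (@le_lt_trans _ _ ((rnorm a + 1) * (w i * rnorm (x i)) + w i * rnorm (y i)))//.
  rewrite mulrCA -mulrDr ler_wpM2l ?(ltW (w_gt0 i))// (le_trans (ler_rnormD _ _))//.
  by rewrite lerD2r rnormM ler_wpM2r ?rnorm_ge0// lerDl.
by rewrite [e]splitr ltrD// mulrC -ltr_pdivlMr.
Qed.

Lemma c0wB x y : E x -> E y -> E (x - y).
Proof. by move=> Ex Ey; rewrite addrC -scaleN1r; exact: c0wZD. Qed.

Lemma c0w_solid x y : E y -> (forall i, rnorm (x i) <= rnorm (y i)) ->
  E x /\ N x <= N y.
Proof.
move=> Ey xy; have wxy i : w i * rnorm (x i) <= w i * rnorm (y i).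
  by rewrite ler_wpM2l// ltW.
split; last by apply: c0w_norm_le => i; exact: le_trans (wxy i) (c0w_norm_ge i Ey).
move=> e /Ey; apply: sub_finite_set => i /= /le_trans; apply; exact: wxy.
Qed.

(** The limit is taken coordinatewise, and convergence is uniform after weighting. A level set of
    the limit at [e] lies in a level set of some [u k] at [e / 2], hence is finite. *)
Lemma c0w_complete (u : nat -> I -> R[i]) : (forall n, E (u n)) ->
  (forall e, 0 < e -> exists k, forall m n, (k <= m)%N -> (k <= n)%N ->
     N (u m - u n) < e) ->
  exists2 l, E l & N (u n - l) @[n --> \oo] --> (0 : R).
Proof.
move=> Eu uc.
have coord i : exists l, forall e : R, 0 < e -> exists k, forall n, (k <= n)%N ->
    rnorm (u n i - l) < e.
  apply: complex_cauchy_cvg => e e0.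
  have [k Hk] := uc _ (mulr_gt0 (w_gt0 i) e0); exists k => m n km kn.
  rewrite -(ltr_pM2l (w_gt0 i)) (le_lt_trans _ (Hk m n km kn))//.
  exact: (@c0w_norm_ge (u m - u n) i (c0wB (Eu m) (Eu n))).
have [l lP] := choice coord.
have ul e : 0 < e -> exists k, forall n, (k <= n)%N -> forall i,
    w i * rnorm (u n i - l i) <= e.
  move=> e0; have [k Hk] := uc e e0; exists k => n kn i.
  apply/ler_addgt0Pr => d d0; have [k' Hk'] := lP i _ (divr_gt0 d0 (w_gt0 i)).
  (* The auxiliary index [m] may depend on the coordinate [i]; the index [k] does not, which gives
     uniformity. *)
  pose m := maxn k k'.
  have := Hk' m (leq_maxr _ _); rewrite ltr_pdivlMr// mulrC => /ltW um.
  have := Hk n m kn (leq_maxl _ _) => /ltW nm.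
  have -> : u n i - l i = (u n i - u m i) + (u m i - l i) by rewrite subrKA.
  rewrite (le_trans (ler_wpM2l (ltW (w_gt0 i)) (ler_rnormD _ _)))// mulrDr lerD//.
  apply: le_trans nm.
  exact: (@c0w_norm_ge (u n - u m) i (c0wB (Eu n) (Eu m))).
have El : E l.
  move=> e e0; have e20 : 0 < e / 2 by rewrite divr_gt0.
  have [k Hk] := ul _ e20; apply: sub_finite_set (Eu k _ e20) => i /= ei.
  have := Hk k (leqnn k) i; rewrite rnormB => kl.
  have := ler_wpM2l (ltW (w_gt0 i)) (ler_rnormD (l i - u k i) (u k i)).
  rewrite subrK mulrDr; move: ei kl.
  by move: (w i * _) (w i * _) (w i * _) => p q r; lra.
exists l => //; apply/cvgrPdist_le => e /ul[k Hk]; exists k => // n /= kn.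
rewrite sub0r normrN ger0_norm; last exact: c0w_norm_ge0 (c0wB (Eu n) El).
by apply: c0w_norm_le => i; exact: Hk.
Qed.

Lemma c0w_normZ_le (a : R[i]) x : E x -> N (a *: x) <= rnorm a * N x.
Proof.
move=> Ex; apply: c0w_norm_le => i; rewrite !fctE rnormM mulrCA.
by rewrite ler_wpM2l ?rnorm_ge0//; exact: c0w_norm_ge.
Qed.

Lemma c0w_banach : banach_function_space E N.
Proof.
have EZ (a : R[i]) x : E x -> E (a *: x).
  by move=> Ex; have := c0wZD a Ex c0w0; rewrite addr0.
split.
- exact: c0w0.
- exact: c0wZD.
- move=> x y Ex Ey; apply: c0w_norm_le => i.
  apply: le_trans (ler_wpM2l (ltW (w_gt0 i)) (ler_rnormD _ _)) _.
  by rewrite mulrDr lerD//; exact: c0w_norm_ge.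
- move=> a x Ex; apply/eqP; rewrite eq_le c0w_normZ_le// andTb.
  have [->|a0] := eqVneq a 0.
    by rewrite rnorm0 mul0r; apply/c0w_norm_ge0/EZ.
  have na : 0 < rnorm a by rewrite rnorm_gt0.
  rewrite -ler_pdivlMl// -{1}[x](scalerK a0).
  rewrite (le_trans (c0w_normZ_le _ (EZ a x Ex)))//.
  rewrite ler_wpM2r ?(c0w_norm_ge0 (EZ a x Ex))// -[leRHS]mul1r ler_pdivlMr//.
  by rewrite -rnormM mulVf// rnorm1.
- exact: c0w_norm_eq.
- exact: c0w_complete.
Qed.

Lemma c0w_dense x (e : R) : E x -> 0 < e -> exists2 y, c00 y & N (x - y) < e.
Proof.
move=> Ex e0; have e20 : 0 < e / 2 by rewrite divr_gt0.
(* Truncating at [e / 2] keeps the supremum of the remainder strictly below [e]. *)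
exists (fun i => if e / 2 <= w i * rnorm (x i) then x i else 0).
  apply: sub_finite_set (Ex _ e20) => i /=.
  by case: ifP => //; rewrite eqxx.
apply: (@le_lt_trans _ _ (e / 2)); last by rewrite ltr_pdivrMr// ltr_pMr// ltr1n.
apply: c0w_norm_le => i.
change (w i * rnorm (x i - if e / 2 <= w i * rnorm (x i) then x i else 0)
  <= e / 2).
case: (leP (e / 2) (w i * rnorm (x i))) => [_|/ltW h].
  by rewrite subrr rnorm0 mulr0 ltW.
by rewrite subr0.
Qed.

Lemma c0w_lattice : 1 <= inf (range w) -> banach_sequence_lattice E N.
Proof.
move=> w1; have w0 := lt_le_trans ltr01 w1; split.
- exact: c0w_banach.
- exact: c0w_c00.
- exact: c0w_linfty.
- by move=> x Ex e; exact: c0w_dense.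
- by move=> x y Ey _; exact: c0w_solid.
- move=> x Ex; apply: ge_sup.
    by case: I_neq0 => i _; exists (rnorm (x i)), i.
  move=> _ [i _ <-]; apply: le_trans (c0w_norm_ge i Ex).
  by rewrite ler_peMl ?rnorm_ge0// (le_trans w1)// weight_inf_le.
Qed.

(** The characteristic function of a point has supremum norm one and lattice norm [w i]. *)
Lemma lattice_weight_inf : banach_sequence_lattice E N -> 1 <= inf (range w).
Proof.
move=> HE; apply: lb_le_inf; first by case: weight_has_inf.
move=> _ [i _ <-]; rewrite -c0w_norm_chi1.
by apply: (bsl_chi_ge1 HE (i := i)); rewrite inE.
Qed.

End WeightedC0.

(* Needed because [C_E ^+ 2 * sup_AM] is [0] when [C_E = +oo] and [sup_AM = 0]. *)
Lemma AM_le0 (R : realType) (A : banachAlgType R[i]) (a : A) :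
  (AM A <= 0)%E -> a = 0.
Proof.
move=> AM0; apply: contrapT => /eqP/nonzero_functional[f fa].
have fa0 : 0 < rnorm (f a) by rewrite rnorm_gt0.
pose g := bop_comp (bop_comp f (lmul a)) (product_map A).
have g1 : 0 < rnorm g + 1 by rewrite ltr_wpDl ?rnorm_ge0.
have k0 : 0 < rnorm (f a) / (rnorm g + 1) by rewrite divr_gt0.
(* A diagonal with norm below this threshold would make [rnorm (M g)] smaller than [rnorm (f a)],
   yet [M g = f a]. *)
have [|M HM Mk] := @virtual_diagonal_near R A (rnorm (f a) / (rnorm g + 1)).
  by rewrite (le_lt_trans AM0).
have := ler_rnorm_bop M g; rewrite (((virtual_diagonalP M).1 HM).2 a f).1.
rewrite leNgt => /negP; apply; apply: le_lt_trans (ler_wpM2r (rnorm_ge0 g) Mk) _.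
by rewrite -mulrA gtr_pMr// ltr_pdivrMl// mulr1 ltrDl.
Qed.

(** On the zero algebra, [0] is a virtual diagonal. *)
Lemma AM_zero (R : realType) (A : banachAlgType R[i]) :
  (forall a : A, a = 0) -> AM A = 0%E.
Proof.
move=> A0; apply/eqP; rewrite eq_le AM_ge0 andbT.
rewrite -[0%E]/(0%:E) -(rnorm0 (bidual (ptensor A A))).
apply: virtual_diagonal_AM_le; apply/virtual_diagonalP; split=> // a f.
by rewrite [in f a](A0 a) linear0.
Qed.

(** * Bounds for the amenability constant of an E-sum *)

Section ESumBounds.
Variables (R : realType) (I : choiceType).
Variables (E : set (I -> R[i])) (N : (I -> R[i]) -> R).
Variable HE : banach_sequence_lattice E N.
Variable A : I -> banachAlgType R[i].
Local Notation S := (esum HE A).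
Local Notation sup_AM := (ereal_sup (range (fun i => AM (A i)))).

(** The infimum defining [AM] may not be attained; the strict inequality still provides a diagonal
    of norm at most [K] in every [A i]. *)
Lemma esum_near_diagonal (C K : R) : (forall F, N (chi R F) <= C) -> 0 <= K ->
  (sup_AM < K%:E)%E ->
  exists2 D : bidual (ptensor S S), virtual_diagonal D & rnorm D <= C ^+ 2 * K.
Proof.
move=> NC K0 supK.
have ex i : exists M : bidual (ptensor (A i) (A i)),
    virtual_diagonal M /\ rnorm M <= K.
  have [|M HM MK] := @virtual_diagonal_near R (A i) K; last by exists M.
  by rewrite (le_lt_trans _ supK)//; apply: ereal_sup_ubound; exists i.
pose M i := projT1 (cid (ex i)).
have MP i : virtual_diagonal (M i) /\ rnorm (M i) <= K := projT2 (cid (ex i)).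
exact: (esum_virtual_diagonal HE NC K0 (fun i => (MP i).1) (fun i => (MP i).2)).
Qed.

Lemma AM_esum_ge : (sup_AM <= AM S)%E.
Proof. by apply: ge_ereal_sup => _ [i _ <-]; exact: AM_le_esum. Qed.

Lemma AM_esum_le : [set: I] !=set0 ->
  (AM S <= lattice_const N ^+ 2 * sup_AM)%E.
Proof.
move=> [i0 _].
have chiC F : ((N (chi R F))%:E <= lattice_const N)%E.
  by apply: ereal_sup_ubound; exists F.
have C1 : (1 <= lattice_const N)%E.
  apply: le_trans (chiC [fset i0]%fset); rewrite lee_fin.
  by apply: (bsl_chi_ge1 HE (i := i0)); rewrite inE.
have sup0 i : (AM (A i) <= sup_AM)%E by apply: ereal_sup_ubound; exists i.
(* If the supremum is zero, all the algebras vanish, and both sides are zero even for an infinite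
   lattice constant. Otherwise an infinite factor makes the right-hand side [+oo]. *)
have [s0|s0] := leP sup_AM 0%E.
  have A0 i (x : A i) : x = 0 by apply/AM_le0/(le_trans (sup0 i)).
  have -> : AM S = 0%E by apply: AM_zero => a; apply: esumP => i; exact: A0.
  have -> : sup_AM = 0%E.
    by apply/eqP; rewrite eq_le s0 (le_trans (AM_ge0 (A i0))).
  by rewrite mule0.
move: C1 chiC; case: (lattice_const N) => [C| |] // C1 chiC; last first.
  by rewrite expe2 mulyy gt0_mulye ?leey.
have C0 : 0 < C by rewrite -lte_fin (lt_le_trans _ C1)// lte_fin.
have C20 : 0 < C ^+ 2 by rewrite exprn_gt0.
have NC F : N (chi R F) <= C by rewrite -lee_fin.
rewrite -EFin_expe; move: s0; case supE: sup_AM => [r| |] // r0; last first.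
  by rewrite gt0_muley ?leey// lte_fin.
(* The slack [e / C ^+ 2] becomes [e] once multiplied by [C ^+ 2]. *)
apply/lee_addgt0Pr => e e0; have e' : 0 < e / C ^+ 2 by rewrite divr_gt0.
have [| |D HD DK] := @esum_near_diagonal C (r + e / C ^+ 2) NC.
- by rewrite addr_ge0 ?ltW// -lte_fin.
- by rewrite supE lte_fin ltrDl.
apply: le_trans (virtual_diagonal_AM_le HD) _.
rewrite -EFinM -EFinD lee_fin (le_trans DK)// mulrDr.
by rewrite [C ^+ 2 * (e / _)]mulrC divfK ?gt_eqF.
Qed.

Lemma esum_amenable (C : R) : (forall F, N (chi R F) <= C) ->
  (sup_AM < +oo)%E -> amenable S.
Proof.
move=> NC; case supE: sup_AM => [r| |] // _.
- have [| |D HD _] := @esum_near_diagonal C (`|r| + 1) NC; last by exists D.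
    by rewrite addr_ge0.
  by rewrite supE lte_fin (le_lt_trans (ler_norm r))// ltrDl.
(* The value [-oo] is the supremum over an empty [I]. *)
- have [| |D HD _] := @esum_near_diagonal C 1 NC; last by exists D.
    exact: ler01.
  by rewrite supE ltNyr.
Qed.

(* [pi** M] acts as an identity on [A i], on which [1 / w i] bounds the norm of
   the coordinate projection. *)
Lemma amenable_weight_bound (w : I -> R) (M : bidual (ptensor S S)) i (z : A i) :
  0 < w i -> (forall x, E x -> w i * rnorm (x i) <= N x) -> z != 0 ->
  virtual_diagonal M -> w i <= 2 * (rnorm M * rnorm (product_map S)).
Proof.
move=> w0 wN /nonzero_functional[f fz] /virtual_diagonalP[_ Md].
have f0 : 0 < rnorm f.
  by rewrite rnorm_gt0; apply: contra_neq fz => ->.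
(* Norming [f] up to a factor one half is the origin of the [2] in the bound. *)
have [x fx] : exists x, rnorm f / 2 * rnorm x < rnorm (f x).
  apply: contrapT => nx; suff : rnorm f <= rnorm f / 2 by move: (rnorm f) f0 => r; lra.
  apply: opnorm_le => [|x]; first by rewrite divr_ge0// ltW.
  by rewrite leNgt; apply/negP => fx; apply: nx; exists x.
have x0 : 0 < rnorm x.
  rewrite rnorm_gt0; apply: contraTneq fx => ->.
  by rewrite linear0 !rnorm0 mulr0 ltxx.
(* This functional is [a |-> f (bmul x (a i))]; estimating [rnorm (a i)] by [rnorm a / w i] gives
   the gain of [1 / w i]. *)
pose g : dual S := bop_comp (bop_comp f (esum_proj HE A i)) (lmul (esum_inj HE A i x)).
have gn : rnorm g <= rnorm f * rnorm x / w i.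
  apply: opnorm_le => [|a]; first by rewrite divr_ge0 ?mulr_ge0// ltW.
  have -> : g a = f (bmul x (a i)).
    change (f (bmul ((esum_inj HE A i x : S) i) (a i)) = f (bmul x (a i))).
    by rewrite esum_inj_in.
  apply: le_trans (ler_rnorm_bop f _) _; rewrite -!mulrA ler_wpM2l ?rnorm_ge0//.
  rewrite (le_trans (ler_rnorm_bmul _ _))// ler_wpM2l ?rnorm_ge0//.
  rewrite ler_pdivlMl//; have := wN _ (esumE a); rewrite rnorm_norm; exact.
have := (Md (esum_inj HE A i x) (bop_comp f (esum_proj HE A i))).1.
have -> : bop_comp f (esum_proj HE A i) (esum_inj HE A i x) = f x.
  by rewrite /= -[X in f X]/((esum_inj HE A i x : S) i) esum_inj_in.
rewrite -/g => gx; move: fx; rewrite -gx => fx.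
have := lt_le_trans fx (ler_rnorm_bop M _) => {}fx.
have := lt_le_trans fx (ler_wpM2l (rnorm_ge0 M) (rnorm_bop_comp g (product_map S))).
move=> {}fx.
have := lt_le_trans fx
  (ler_wpM2l (rnorm_ge0 M) (ler_wpM2r (rnorm_ge0 (product_map S)) gn)).
move=> {}fx; have fx0 : 0 < rnorm f * rnorm x by rewrite mulr_gt0.
(* Both sides are brought to a multiple of [rnorm f * rnorm x], which then cancels. *)
rewrite (_ : _ * rnorm x = rnorm f * rnorm x * 2^-1) in fx; last by ring.
rewrite (_ : rnorm M * _ =
  rnorm f * rnorm x * (rnorm M * rnorm (product_map S) / w i)) in fx; last by ring.
move: fx; rewrite ltr_pM2l// ltr_pdivlMr// => /ltW.
by rewrite mulrC ler_pdivrMr// [_ * 2]mulrC.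
Qed.

End ESumBounds.

(** In (c), [HE] is quantified because it is a parameter of [esum]; by (a), the condition on the
    infimum of the weights provides one. *)
Theorem proposition5p2 (R : realType) (I : choiceType) (w : I -> R)
    (I_neq0 : [set: I] !=set0) (w_gt0 : forall i, 0 < w i) :
  let E : set (I -> R[i]) := c0w w in
  let N : (I -> R[i]) -> R := c0w_norm w in
  let C_E : \bar R := lattice_const N in
  let sup_w : \bar R := ereal_sup (range (fun i => (w i)%:E)) in
  (* (a) *)
  ((E `<=` linfty (R := R) (I := I) <-> 0 < inf (range w)) /\
   (banach_sequence_lattice E N <-> 1 <= inf (range w))) /\
  (* (b) *)
  ((forall F : {fset I}, F != fset0 ->
      N (chi R F) = \big[Num.max/0]_(i <- F) w i) /\
   C_E = sup_w /\
   (banach_sequence_lattice E N -> (1 <= C_E <= +oo)%E)) /\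
  (* (c) *)
  (1 <= inf (range w) ->
   forall (HE : banach_sequence_lattice E N) (A : I -> banachAlgType R[i]),
     let sup_AM : \bar R := ereal_sup (range (fun i => AM (A i))) in
     [/\ (sup_AM <= AM (esum HE A))%E,
         (AM (esum HE A) <= C_E ^+ 2 * sup_AM)%E,
         (C_E ^+ 2 * sup_AM = sup_w ^+ 2 * sup_AM)%E,
         (sup_w < +oo)%E -> (sup_AM < +oo)%E -> amenable (esum HE A) &
         infinite_set [set: I] -> (forall i, exists a : A i, a != 0) ->
           amenable (esum HE A) -> (sup_w < +oo)%E]).
Proof.
move=> E N C_E sup_w.
have C_Ew : C_E = sup_w by exact: lattice_const_c0w.
have wE i : ((w i)%:E <= sup_w)%E by apply: ereal_sup_ubound; exists i.
split; [split; split|split; [split; [|split=> [|HE]]|]].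
- exact: linfty_weight_inf.
- exact: c0w_linfty.
- exact: lattice_weight_inf.
- exact: c0w_lattice.
- by move=> F _; exact: c0w_norm_chi.
- exact: C_Ew.
- have [i _] := I_neq0; rewrite leey andbT C_Ew (le_trans _ (wE i))// lee_fin.
  by rewrite (le_trans (lattice_weight_inf I_neq0 w_gt0 HE))// weight_inf_le.
- move=> _ HE A sup_AM; split.
  + exact: AM_esum_ge.
  + exact: (AM_esum_le HE A I_neq0).
  + by rewrite C_Ew.
  + rewrite -C_Ew => C_fin AM_fin.
    have NC F : ((N (chi R F))%:E <= C_E)%E by apply: ereal_sup_ubound; exists F.
    case: C_E C_Ew C_fin NC => [C| |] // _ _ NC.
      by apply: (@esum_amenable _ _ _ _ HE A C _ AM_fin) => F; rewrite -lee_fin.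
    by have := NC fset0.
  + move=> _ A0 [M HM].
    (* The bound from [amenable_weight_bound] is the same for all [i], so it bounds the supremum. *)
    apply: (@le_lt_trans _ _ (2 * (rnorm M * rnorm (product_map (esum HE A))))%:E).
      apply: ge_ereal_sup => _ [i _ <-]; rewrite lee_fin; have [z z0] := A0 i.
      apply: amenable_weight_bound (w_gt0 i) _ z0 HM => x; exact: c0w_norm_ge.
    exact: ltry.
Qed.
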